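(* Let $\mathcal E$ be an arbitrary Hilbert space and let $T\in B(F^2(H_n)\otimes\mathcal E)$ be a positive multi-Toeplitz operator. Then $T$ has a maximal outer factor, i.e. there exist a Hilbert space $\mathcal G$ and an outer multi-analytic operator $M_\varphi\in R_n^\infty\bar\otimes B(\mathcal E,\mathcal G)$ such that (a) $M_\varphi^*M_\varphi\le T$, and (b) whenever $\mathcal N$ is a Hilbert space and $M_\theta\in R_n^\infty\bar\otimes B(\mathcal E,\mathcal N)$ satisfies $M_\theta^*M_\theta\le T$, then $M_\theta^*M_\theta\le M_\varphi^*M_\varphi$. Moreover, the maximal outer factor is unique up to a unitary constant (diagonal) multi-analytic operator: if $M_{\varphi'}\in R_n^\infty\bar\otimes B(\mathcal E,\mathcal G')$ is another maximal outer factor of $T$, then $M_{\varphi'}=(I_{F^2(H_n)}\otimes U)M_\varphi$ for some unitary $U\in B(\mathcal G,\mathcal G')$.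
   Context: $H_n$ is an $n$-dimensional Hilbert space ($n\in\{1,2,\dots\}$ or $n=\infty$) with orthonormal basis $e_1,\dots,e_n$; $F^2(H_n)=\bigoplus_{k\ge0}H_n^{\otimes k}$ is the full Fock space, $H_n^{\otimes0}=\mathbb C1$. $\mathbb F_n^+$ is the free semigroup on generators $g_1,\dots,g_n$ with identity $g_0$; for $\alpha=g_{i_1}\cdots g_{i_k}$ put $e_\alpha=e_{i_1}\otimes\cdots\otimes e_{i_k}$, $e_{g_0}=1$. The left creation operators are $S_i\psi=e_i\otimes\psi$ and the right creation operators are $R_i\psi=\psi\otimes e_i$ on $F^2(H_n)$; for operators $X_1,\dots,X_n$, $X_\alpha=X_{i_1}\cdots X_{i_k}$, $X_{g_0}=I$. $R_n^\infty$ is the WOT-closed algebra generated by $R_1,\dots,R_n$ and $I$. An operator $M\in B(F^2(H_n)\otimes\mathcal K,F^2(H_n)\otimes\mathcal K')$ is multi-analytic if $M(S_i\otimes I_{\mathcal K})=(S_i\otimes I_{\mathcal K'})M$ for all $i$; the set of such operators is denoted $R_n^\infty\bar\otimes B(\mathcal K,\mathcal K')$. Its symbol is $\theta:\mathcal K\to F^2(H_n)\otimes\mathcal K'$, $\theta k=M(1\otimes k)$, and we write $M=M_\theta$. $M_\theta$ is outer if $\bigvee_{\alpha\in\mathbb F_n^+}(S_\alpha\otimes I_{\mathcal K'})\theta\mathcal K=F^2(H_n)\otimes\mathcal K'$. A bounded operator $T$ on $F^2(H_n)\otimes\mathcal E$ is multi-Toeplitz if $(S_i\otimes I_{\mathcal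 E})^*T(S_j\otimes I_{\mathcal E})=\delta_{ij}T$ for all $i,j=1,\dots,n$. *)

(* Defs.v *)
From HB Require Import structures.
From mathcomp Require Import all_boot all_algebra complex.
From mathcomp Require Import all_classical all_reals ereal esum.
Set Implicit Arguments. Unset Strict Implicit. Unset Printing Implicit Defensive.
Import GRing.Theory Num.Theory.
Local Open Scope ring_scope.

Record hilbert (R : realType) := Hilbert {
  hcar :> lmodType R[i];
  hinner : hcar -> hcar -> R[i];
  hinner_linear : forall (a : R[i]) (x y z : hcar),
      hinner (a *: x + y) z = a * hinner x z + hinner y z;
  hinner_sym : forall x y : hcar, hinner y x = (hinner x y)^*;
  hinner_ge0 : forall x : hcar, 0 <= hinner x x;
  hinner_eq0 : forall x : hcar, hinner x x = 0 -> x = 0;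
  hcomplete : forall u : nat -> hcar,
      (forall e : R, 0 < e -> exists N : nat, forall m k : nat, (N <= m)%N -> (N <= k)%N ->
          complex.Re (hinner (u m - u k) (u m - u k)) < e) ->
      exists x : hcar, forall e : R, 0 < e -> exists N : nat, forall k : nat, (N <= k)%N ->
          complex.Re (hinner (u k - x) (u k - x)) < e
}.

Definition hnormsq (R : realType) (V : hilbert R) (x : V) : R :=
  complex.Re (hinner x x).

Definition unitary (R : realType) (V W : hilbert R) (U : V -> W) : Prop :=
  [/\ forall (a : R[i]) (x y : V), U (a *: x + y) = a *: U x + U y,
      forall x y : V, hinner (U x) (U y) = hinner x y
    & forall z : W, exists x : V, U x = z].

(* n : option nat, Some k = k generators (k >= 1), None = n = infinity. *)
(* Generators g_1, g_2, ... are coded by the naturals 0, 1, ... ;       *)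
(* a word alpha = g_{i1}...g_{ik} is the list [:: i1; ...; ik]; the     *)
(* empty list is the identity g_0.                                      *)
(* F^2(H_n) (x) V is identified with l^2(F_n^+, V) via                  *)
(* e_alpha (x) v  <->  (the function alpha |-> v, 0 elsewhere).         *)
Definition validg (n : option nat) (i : nat) : bool :=
  if n is Some k then (i < k)%N else true.
Definition validw (n : option nat) (w : seq nat) : bool := all (validg n) w.

Definition fock (R : realType) (V : hilbert R) := seq nat -> V.

Section Fock.
Variables (R : realType) (n : option nat).

Definition fnormsqE (V : hilbert R) (f : fock V) : \bar R :=
  (\esum_(w in [set w | validw n w]) (hnormsq (f w))%:E)%E.

Definition inl2 (V : hilbert R) (f : fock V) : Prop :=
  (fnormsqE f < +oo)%E /\ (forall w, ~~ validw n w -> f w = 0).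

Definition fnormsq (V : hilbert R) (f : fock V) : R := fine (fnormsqE f).

(* inner product of F^2(H_n) (x) V, given by the polarization identity *)
Definition finner (V : hilbert R) (f g : fock V) : R[i] :=
  4^-1 * \sum_(k < 4) 'i ^+ k * ((fnormsq (f + 'i ^+ k *: g))%:C)%C.

(* bounded linear operators F^2(H_n) (x) V -> F^2(H_n) (x) W
   (only their action on F^2(H_n) (x) V matters) *)
Definition bounded_op (V W : hilbert R) (A : fock V -> fock W) : Prop :=
  [/\ forall f, inl2 f -> inl2 (A f),
      forall (a : R[i]) (f g : fock V), inl2 f -> inl2 g ->
        A (a *: f + g) = a *: A f + A g
    & exists c : R, forall f, inl2 f -> fnormsq (A f) <= c * fnormsq f].

(* S_i (x) I_V : left creation operator, e_alpha (x) v |-> e_{g_i alpha} (x) v *)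
Definition Sft (V : hilbert R) (i : nat) (f : fock V) : fock V :=
  fun w => if w is j :: w' then (if j == i then f w' else 0) else 0.

Definition Sword (V : hilbert R) (alpha : seq nat) (f : fock V) : fock V :=
  foldr (@Sft V) f alpha.

Definition one_tensor (V : hilbert R) (v : V) : fock V :=
  fun w => if w is [::] then v else 0.

Definition multi_analytic (V W : hilbert R) (M : fock V -> fock W) : Prop :=
  bounded_op M /\
  forall i, validg n i -> forall f, inl2 f -> M (Sft i f) = Sft i (M f).

Definition symbol (V W : hilbert R) (M : fock V -> fock W) (k : V) : fock W :=
  M (one_tensor k).

Inductive in_span (W : hilbert R) (S : fock W -> Prop) : fock W -> Prop :=
| span0 : in_span S 0
| spanS : forall g (c : R[i]) v, in_span S g -> S v -> in_span S (g + c *: v).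

Definition outer (V W : hilbert R) (M : fock V -> fock W) : Prop :=
  forall f : fock W, inl2 f -> forall e : R, 0 < e ->
    exists g, in_span (fun v => exists alpha (k : V),
                          validw n alpha /\ v = Sword alpha (symbol M k)) g
              /\ fnormsq (f - g) < e.

Definition multi_toeplitz (V : hilbert R) (T : fock V -> fock V) : Prop :=
  bounded_op T /\
  forall i j, validg n i -> validg n j -> forall f g, inl2 f -> inl2 g ->
    finner (T (Sft j f)) (Sft i g) = (i == j)%:R * finner (T f) g.

Definition positive_op (V : hilbert R) (T : fock V -> fock V) : Prop :=
  forall f, inl2 f -> 0 <= finner (T f) f.

(* M^* M <= T, i.e. <M^*M f, f> = ||M f||^2 <= <T f, f> *)
Definition MM_le (V W : hilbert R) (M : fock V -> fock W) (T : fock V -> fock V) : Prop :=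
  forall f, inl2 f -> ((fnormsq (M f))%:C)%C <= finner (T f) f.

Definition MM_le_MM (V W W' : hilbert R) (M : fock V -> fock W) (M' : fock V -> fock W') : Prop :=
  forall f, inl2 f -> fnormsq (M f) <= fnormsq (M' f).

Definition max_outer_factor (E G : hilbert R) (T : fock E -> fock E) (M : fock E -> fock G) : Prop :=
  [/\ multi_analytic M, outer M, MM_le M T &
      forall (N : hilbert R) (Th : fock E -> fock N),
        multi_analytic Th -> MM_le Th T -> MM_le_MM Th M].

End Fock.

(* Main.v *)
From HB Require Import structures.
Require Import Defs.
From mathcomp Require Import all_boot all_order all_algebra complex ring lra.
From mathcomp Require Import all_classical all_reals ereal esum topology normedtype sequences.
Set Implicit Arguments. Unset Strict Implicit. Unset Printing Implicit Defensive.
Import Order.TTheory GRing.Theory Num.Theory numFieldNormedType.Exports.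
Local Open Scope ring_scope.

(** Complete [l2(words, E)] for the form [<T f, g>] to a Hilbert space [K].  By the
multi-Toeplitz identity the creation operators induce isometries [L_i] of [K] with
orthogonal ranges.  Let [G] be the wandering space [K - \/ L_i K] and let [phi f]
have coefficients [P_G L_w^* f]; this is the shift part of the Wold decomposition of
the row isometry, so [||phi f||^2 <= <T f, f>] and [phi] is outer.  If [f = y + z]
splits [f] into its shift part [y] and its remainder [z], then [z] is a limit of
functions supported on words of length at least [m], for every [m].  An analytic
[theta] with [theta^* theta <= T] maps such functions to functions vanishing on words
shorter than [m], so each coefficient of [theta f] only sees [y].

For uniqueness, two maximal factors have the same Gram form [<phi f, phi g>].  Since
[phi] is outer, the vacuum component of [phi v] is a limit of [phi (v - g)] with [g]
vanishing on the empty word, and the same [g] work for [phi']; hence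
[phi v (empty) |-> phi' v (empty)] is isometric, and it intertwines all coefficients. *)

(** * Semi-inner products *)

(** Why the remainder [z] is a limit of functions supported on long words: let [p] be the projection
    of [z] onto the closure of their images. Then [z - p] is orthogonal to every [L_w (iota v)] with
    [size w = m], so all [L_w^*] of length [m] kill it. A vector without Fock coefficients is
    orthogonal to everything killed in this way, hence [z] is orthogonal to [z - p] and [z = p].
    Working with common kernels of the [L_w^*], rather than with sums over all words of length [m],
    treats finitely and infinitely many generators alike. Two conventions shape the rest. Limits are
    taken of real parts only; a complex form is recovered from its real part through multiplication
    by ['i]. Subspaces are never assumed closed: a projection is a vector that elements of the
    subspace approximate, and density is often stated as the vanishing of everything orthogonal.
    Riesz representation by minimization then supplies projections, adjoints and extensions by
    continuity at once. *)

Lemma conj_conjc (R : realType) (x : R[i]) : Num.conj x = conjc x.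
Proof. by []. Qed.

Lemma discriminant_le (R : realType) (a b c : R) : 0 <= a -> 0 <= c ->
  (forall t, 0 <= a + 2 * t * b + t ^+ 2 * c) -> b ^+ 2 <= a * c.
Proof.
move=> a0 c0 h.
move: c0; rewrite [0 <= c]le_eqVlt => /orP[/eqP c0|c0].
  have [->|b0] := eqVneq b 0; first by rewrite -c0; lra.
  (* At this [t] the polynomial, now of degree one, takes the value [-1]. *)
  have := h (- (a + 1) / (2 * b)); rewrite -c0 mulr0 addr0.
  have -> : 2 * (- (a + 1) / (2 * b)) * b = - (a + 1) by field.
  by lra.
have := h (- b / c).
have -> : a + 2 * (- b / c) * b + (- b / c) ^+ 2 * c
   = (a * c - b ^+ 2) / c by field; rewrite gt_eqF.
rewrite -[_ <= a * c]subr_ge0 => g.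
by rewrite -(pmulr_lge0 _ (_ : 0 < c^-1)) ?invr_gt0.
Qed.

Section Forms.
Variables (R : realType) (V : lmodType R[i]).
Implicit Types (B : V -> V -> R[i]) (u v w : V).

Definition form B : Prop :=
  [/\ forall a u v w, B (a *: u + v) w = a * B u w + B v w,
      forall u v, B v u = (B u v)^*
    & forall u, 0 <= B u u].

Definition re B u v : R := complex.Re (B u v).

Definition sq B u : R := complex.Re (B u u).

Variables (B : V -> V -> R[i]) (FB : form B).
Local Notation r := (re B).
Local Notation q := (sq B).

Lemma reC u v : r u v = r v u.
Proof. by case: FB => _ h _; rewrite /re [B v u]h conj_conjc; case: (B u v). Qed.

Lemma formDl u v w : B (u + v) w = B u w + B v w.
Proof. by case: FB => h _ _; have := h 1 u v w; rewrite scale1r mul1r. Qed.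

Lemma form0l w : B 0 w = 0.
Proof. by apply: (addrI (B 0 w)); rewrite -formDl !addr0. Qed.

Lemma formZl a u w : B (a *: u) w = a * B u w.
Proof. by case: FB => h _ _; rewrite -[a *: u]addr0 h form0l addr0. Qed.

Lemma formZr a u w : B w (a *: u) = conjc a * B w u.
Proof. by case: FB => _ h _; rewrite !(h _ w) formZl rmorphM. Qed.

Lemma formDr u v w : B w (u + v) = B w u + B w v.
Proof. by case: FB => _ h _; rewrite !(h _ w) formDl rmorphD. Qed.

Lemma form0r w : B w 0 = 0.
Proof. by rewrite -[0 in LHS](scale0r (0 : V)) formZr rmorph0 mul0r. Qed.

Lemma reDl u v w : r (u + v) w = r u w + r v w.
Proof. by rewrite /re formDl raddfD. Qed.

Lemma reZl (s : R) u w : r (s%:C%C *: u) w = s * r u w.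
Proof. by rewrite /re formZl; case: (B u w) => a b /=; ring. Qed.

Lemma reNl u w : r (- u) w = - r u w.
Proof.
by rewrite -scaleN1r /re formZl mulN1r raddfN.
Qed.

Lemma reBl u v w : r (u - v) w = r u w - r v w.
Proof. by rewrite reDl reNl. Qed.

Lemma re0l w : r 0 w = 0. Proof. by rewrite /re form0l. Qed.

Lemma reDr u v w : r w (u + v) = r w u + r w v.
Proof. by rewrite !(reC w) reDl. Qed.

Lemma reBr u v w : r w (u - v) = r w u - r w v.
Proof. by rewrite !(reC w) reBl. Qed.

Lemma reNr u w : r w (- u) = - r w u.
Proof. by rewrite !(reC w) reNl. Qed.

Lemma reZr (s : R) u w : r w (s%:C%C *: u) = s * r w u.
Proof. by rewrite !(reC w) reZl. Qed.

Lemma re0r w : r w 0 = 0. Proof. by rewrite reC re0l. Qed.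

Lemma re_ir u v : r u ('i%C *: v) = complex.Im (B u v).
Proof. by rewrite /re formZr; case: (B u v) => a b /=; ring. Qed.

Lemma form_re u v : B u v = (r u v +i* r u ('i%C *: v))%C.
Proof. by rewrite re_ir /re; case: (B u v). Qed.

Lemma sq_ge0 u : 0 <= q u.
Proof. by case: FB => _ _ /(_ u); rewrite lecE => /andP[]. Qed.

Lemma form_sq u : B u u = (q u)%:C%C.
Proof.
case: FB => _ _ /(_ u); rewrite lecE /= => /andP[/eqP h _].
by rewrite /sq; move: h; case: (B u u) => a b /= ->.
Qed.

Lemma sqD u v : q (u + v) = q u + 2 * r u v + q v.
Proof. by rewrite /sq -!/(re B _ _) reDl !reDr (reC v u); ring. Qed.

Lemma sqB u v : q (u - v) = q u - 2 * r u v + q v.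
Proof. by rewrite /sq -!/(re B _ _) reBl !reBr (reC v u); ring. Qed.

Lemma sqN u : q (- u) = q u.
Proof. by rewrite /sq -!/(re B _ _) reNl reNr opprK. Qed.

Lemma sqBC u v : q (u - v) = q (v - u).
Proof. by rewrite -opprB sqN. Qed.

Lemma sq0 : q 0 = 0. Proof. exact: re0l. Qed.

Lemma sqZ a u : q (a *: u) = (complex.Re a ^+ 2 + complex.Im a ^+ 2) * q u.
Proof. by rewrite /sq formZl formZr form_sq; case: a => a b /=; ring. Qed.

Lemma sqZr (s : R) u : q (s%:C%C *: u) = s ^+ 2 * q u.
Proof. by rewrite sqZ /=; ring. Qed.

Lemma re_CS u v : r u v ^+ 2 <= q u * q v.
Proof.
apply: discriminant_le; rewrite ?sq_ge0// => t.
by have := sq_ge0 (u + t%:C%C *: v); rewrite sqD reZr sqZr; lra.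
Qed.

Lemma sqD_le u v : q (u + v) <= 2 * (q u + q v).
Proof. by have := sq_ge0 (u - v); rewrite sqB sqD; lra. Qed.

Lemma sqB_le u v : q (u - v) <= 2 * (q u + q v).
Proof. by rewrite -(sqN v); exact: sqD_le. Qed.

Lemma re_le u v : 2 * r u v <= q u + q v.
Proof. by have := sq_ge0 (u - v); rewrite sqB; lra. Qed.

End Forms.

(** Converse of [form_re]: invariance of [r] under ['i] makes multiplication by ['i] skew-adjoint,
    which is what sesquilinearity requires. Through this lemma a complex inner product can be
    defined by real limits. *)
Lemma form_of_real (R : realType) (V : lmodType R[i]) (r : V -> V -> R) :
  (forall u v w, r (u + v) w = r u w + r v w) ->
  (forall (s : R) u w, r (s%:C%C *: u) w = s * r u w) ->
  (forall u v, r u v = r v u) ->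
  (forall u v, r ('i%C *: u) ('i%C *: v) = r u v) ->
  (forall u, 0 <= r u u) ->
  form (fun u v => (r u v +i* r u ('i%C *: v))%C).
Proof.
move=> rD rZ rC ri rp.
have ii u : 'i%C *: ('i%C *: u) = (-1 : R)%:C%C *: u :> V.
  by rewrite scalerA; congr (_ *: _); rewrite -expr2 sqr_i rmorphN1.
have iN u v : r ('i%C *: u) v = - r u ('i%C *: v).
  by rewrite -(ri ('i%C *: u)) ii rZ mulN1r.
have e (a : R[i]) u : a *: u =
    (complex.Re a)%:C%C *: u + (complex.Im a)%:C%C *: ('i%C *: u) :> V.
  by rewrite scalerA -scalerDl [_ * 'i%C]mulrC -complexE.
split.
- move=> a u v w; rewrite (e a u) !rD !rZ !iN ii; rewrite !(rC u (_%:C%C *: _)) !rZ (rC w).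
  by case: a => a b; apply/eqP; rewrite eq_complex /=; apply/andP; split; apply/eqP; ring.
- by move=> u v; rewrite -[Num.conj _]/(conjc _) /= -iN (rC v) [r v _]rC.
- move=> u; rewrite lecE /= rp andbT.
  by have := iN u u; rewrite rC => h; apply/eqP; lra.
Qed.

Lemma hform (R : realType) (H : hilbert R) : form (@hinner R H).
Proof.
by split; [exact: hinner_linear | exact: hinner_sym | exact: hinner_ge0].
Qed.

(** * Representation by minimization *)

Lemma invS_lt (R : realType) (e : R) : 0 < e ->
  exists N : nat, forall k, (N <= k)%N -> (k.+1%:R)^-1 < e.
Proof.
move=> e0; exists (Num.trunc e^-1) => k Nk.
rewrite invf_plt ?posrE ?ltr0n //.
rewrite (lt_le_trans (truncnS_gt _)) // ler_nat ltnS //.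
Qed.

Lemma le0_of_small (R : realType) (a C : R) :
  (forall e, 0 < e -> a <= e * C) -> a <= 0.
Proof.
move=> h; rewrite leNgt; apply/negP => a0.
have C0 : 0 < C by have := h 1 ltr01; lra.
have := h (a / 2 / C); rewrite !divr_gt0 //.
have -> : a / 2 / C * C = a / 2 by field; rewrite gt_eqF.
by move=> /(_ isT); lra.
Qed.

Lemma le_of_small (R : realType) (a b C : R) :
  (forall e, 0 < e -> a <= b + e * C) -> a <= b.
Proof.
move=> h; rewrite -subr_le0; apply: (@le0_of_small _ _ C) => e /h; lra.
Qed.

Section Riesz.
Variables (R : realType) (H : hilbert R).
Local Notation r := (re (@hinner R H)).
Local Notation q := (sq (@hinner R H)).
Let FH := hform H.

Lemma sq_eq0 (x : H) : q x = 0 -> x = 0.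
Proof. by move=> x0; apply: hinner_eq0; rewrite (form_sq FH) x0. Qed.

Lemma sq_le0 (x : H) : q x <= 0 -> x = 0.
Proof. by move=> x0; apply: sq_eq0; apply/eqP; rewrite eq_le x0 (sq_ge0 FH). Qed.

(* The representing vector is the limit of a minimizing sequence of
   [q (iota v) - 2 * Re (phi v)]. *)
Lemma riesz_min (V : lmodType R[i]) (P : V -> Prop) (iota : V -> H)
    (phi : V -> R[i]) (c : R) :
  (forall a u v, iota (a *: u + v) = a *: iota u + iota v) ->
  (forall a u v, phi (a *: u + v) = conjc a * phi u + phi v) ->
  P 0 -> (forall a u v, P u -> P v -> P (a *: u + v)) -> 0 <= c ->
  (forall v, P v -> complex.Re (phi v) ^+ 2 <= c * q (iota v)) ->
  exists y : H,
  (forall e : R, 0 < e -> exists v, P v /\ q (y - iota v) < e) /\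
  (forall v, P v -> hinner y (iota v) = phi v).
Proof.
move=> iotaP phiP P0 PP c0 phi_le.
have iota0 : iota 0 = 0.
  by have := iotaP (-1) 0 0; rewrite scaler0 addr0 scaleN1r addNr.
have phi0 : phi 0 = 0.
  by have := phiP (-1) 0 0; rewrite scaler0 addr0 rmorphN1 mulN1r addNr.
pose F v := q (iota v) - 2 * complex.Re (phi v).
have F_ge v : P v -> - c <= F v.
  move=> /phi_le; rewrite /F; have := sq_ge0 FH (iota v).
  move: (complex.Re _) (q _) => a d d0 h.
  suff : 2 * a <= c + d by lra.
  have [a0|a0] := leP a 0; first by lra.
  rewrite -(@ler_pXn2r _ 2) ?nnegrE //; try lra.
  by have := sqr_ge0 (c - d); lra.
pose A := [set F v | v in [set v | P v]]%classic.
have infA : has_inf A.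
  split; first by exists (F 0), 0.
  by exists (- c) => _ [v Pv <-]; exact: F_ge.
pose I := inf A.
have I_le v : P v -> 0 <= F v - I.
  by move=> Pv; rewrite subr_ge0; apply: (ge_inf infA.2); exists v.
have reD a u v : complex.Re (phi (a%:C%C *: u + v)) =
    a * complex.Re (phi u) + complex.Re (phi v).
  by rewrite phiP; case: (phi u) (phi v) => [x1 y1] [x2 y2] /=; ring.
(* Approximate Euler equation: [F (t *: w + v) - I] is a nonnegative quadratic polynomial in [t], so
   its discriminant bounds the derivative at [v] in direction [w] by the distance of [F v] from the
   infimum. *)
have K v w : P v -> P w ->
    (r (iota v) (iota w) - complex.Re (phi w)) ^+ 2 <= (F v - I) * q (iota w).
  move=> Pv Pw; apply: discriminant_le; rewrite ?(sq_ge0 FH) ?I_le // => t.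
  have := I_le _ (PP t%:C%C _ _ Pw Pv); rewrite /F reD iotaP (sqD FH) (sqZr FH) (reZl FH).
  by rewrite (reC FH (iota w)); lra.
(* Parallelogram law: the midpoint of [u] and [v] also has [F] at least [I], which forces minimizing
   sequences to be Cauchy. *)
have Kc u v : P u -> P v -> q (iota u - iota v) <= 2 * (F u - I) + 2 * (F v - I).
  move=> Pu Pv.
  pose h : R := 2^-1.
  have Pw := PP h%:C%C _ _ Pu (PP h%:C%C _ _ Pv P0).
  have := I_le _ Pw; rewrite /F !reD !iotaP !(sqB FH) (sqD FH) !(sqZr FH) (sqD FH) !(sqZr FH).
  rewrite (reZl FH) (reDr FH) (reZr FH).
  rewrite iota0 phi0 /= (sq0 FH) !(re0r FH).
  by rewrite (_ : h ^+ 2 = 4^-1) /h; [lra | field].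
have ex k : exists v, P v /\ F v - I < (k.+1%:R)^-1.
  have [|_ [v Pv <-]] := @inf_adherent _ A (k.+1%:R)^-1 _ infA.
    by rewrite invr_gt0.
  by rewrite -/I => Fv; exists v; split => //; rewrite ltrBlDl.
have [u uP] := choice ex.
have [e e0|y yP] := @hcomplete _ H (fun k => iota (u k)).
  have [|N NP] := @invS_lt R (e / 4); first by lra.
  exists N => m k /NP Nm /NP Nk.
  apply: le_lt_trans (Kc _ _ (uP m).1 (uP k).1) _.
  have := lt_trans (uP m).2 Nm; have := lt_trans (uP k).2 Nk.
  by lra.
have yP' e : 0 < e -> exists v, [/\ P v, F v - I < e & q (y - iota v) < e].
  move=> e0; have [N NP] := invS_lt e0; have [M MP] := yP _ e0.
  exists (u (maxn N M)); split; first exact: (uP _).1.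
    by apply: lt_trans (uP _).2 _; apply: NP; rewrite leq_maxl.
  by rewrite (sqBC FH); apply: MP; rewrite leq_maxr.
exists y; split.
  by move=> e /yP' [v [Pv _ ?]]; exists v.
have yre v : P v -> r y (iota v) = complex.Re (phi v).
  move=> Pv; apply/eqP; rewrite -subr_eq0 -sqrf_eq0 eq_le sqr_ge0 andbT.
  apply: (@le0_of_small _ _ (4 * q (iota v))) => e /yP' [w [Pw Fw yw]].
  have k1 := K _ _ Pw Pv; have k2 := re_CS FH (y - iota w) (iota v).
  rewrite (reBl FH) in k2; have q0 := sq_ge0 FH (iota v).
  set a := r y _ in k2 *; set b := r _ _ in k1 k2; set d := complex.Re _ in k1 *.
  have k3 : (a - d) ^+ 2 <= 2 * (a - b) ^+ 2 + 2 * (b - d) ^+ 2.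
    by have := sqr_ge0 ((a - b) - (b - d)); lra.
  have h1 := ler_wpM2r q0 (ltW Fw); have h2 := ler_wpM2r q0 (ltW yw).
  by lra.
move=> v Pv; rewrite (form_re FH) yre //.
have Piv : P ('i%C *: v) by rewrite -[_ *: v]addr0; apply: PP.
have iv : iota ('i%C *: v) = 'i%C *: iota v by rewrite -[_ *: v]addr0 iotaP iota0 addr0.
have pv : phi ('i%C *: v) = conjc 'i%C * phi v by rewrite -[_ *: v]addr0 phiP phi0 addr0.
rewrite -iv yre // pv.
by case: (phi v) => a b /=; congr (_ +i* _)%C; ring.
Qed.

End Riesz.

(** * Sequences *)

Section RealSequences.
Variable R : realType.
Implicit Types (a b : nat -> R).

Lemma tendsP a (l : R) : (a @ \oo --> l)%classic <->
  forall e : R, 0 < e -> exists N, forall n, (N <= n)%N -> `|a n - l| < e.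
Proof.
split=> [/cvgrPdist_lt h e /h[N _ NP]|h].
  by exists N => n /NP /=; rewrite distrC.
by apply/cvgrPdist_lt => e /h[N NP]; exists N => // n /NP /=; rewrite distrC.
Qed.

Lemma tends_uniq a (l m : R) : (a @ \oo --> l)%classic -> (a @ \oo --> m)%classic -> l = m.
Proof. by move=> al am; rewrite -(cvg_lim _ al) // -(cvg_lim _ am). Qed.

Lemma tends_le a b (l m : R) : (a @ \oo --> l)%classic -> (b @ \oo --> m)%classic ->
  (exists N, forall n, (N <= n)%N -> a n <= b n) -> l <= m.
Proof.
move=> al bm [N NP]; rewrite -(cvg_lim _ al) // -(cvg_lim _ bm) //.
apply: ler_lim; [by apply/cvg_ex; exists l | by apply/cvg_ex; exists m |].
by exists N.
Qed.

Lemma tends_cst (l : R) : ((fun=> l) @ \oo --> l)%classic.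
Proof. exact: cvg_cst. Qed.

Lemma sqr_small_norm (x e : R) : 0 < e -> x ^+ 2 < e ^+ 2 -> `|x| < e.
Proof.
by move=> e0; rewrite -(real_normK (num_real x)) ltr_pXn2r ?nnegrE ?normr_ge0 ?ltW.
Qed.

Lemma tends_sqr0 a : ((fun n => a n ^+ 2) @ \oo --> (0 : R))%classic ->
  (a @ \oo --> (0 : R))%classic.
Proof.
move=> /tendsP h; apply/tendsP => e e0; have [N NP] := h _ (exprn_gt0 2 e0).
exists N => n /NP; rewrite !subr0 ger0_norm ?sqr_ge0 // => ?.
exact: sqr_small_norm.
Qed.

Lemma tends_squeeze0 a b : (forall n, 0 <= a n <= b n) ->
  (b @ \oo --> (0 : R))%classic -> (a @ \oo --> (0 : R))%classic.
Proof.
move=> ab b0; apply: (@squeeze_cvgr _ _ _ _ (fun=> 0) b) => //.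
  by near=> n; exact: ab.
exact: tends_cst.
Unshelve. all: by end_near. Qed.

Lemma real_cauchy a :
  (forall e : R, 0 < e -> exists N, forall m k, (N <= m)%N -> (N <= k)%N ->
     (a m - a k) ^+ 2 < e) -> exists l : R, (a @ \oo --> l)%classic.
Proof.
move=> h; suff : cvg (a @ \oo)%classic by move=> /cvg_ex.
apply: R_complete; apply/cauchyP => e e0.
have [N NP] := h _ (exprn_gt0 2 e0).
exists (a N); exists N => // n /= Nn.
exact: sqr_small_norm (NP _ _ (leqnn N) Nn).
Qed.

End RealSequences.

(** * Cauchy sequences in a semi-inner product space *)

Section FormCauchy.
Variables (R : realType) (V : lmodType R[i]) (B : V -> V -> R[i]).
Hypothesis FB : form B.
Local Notation r := (re B).
Local Notation q := (sq B).
Implicit Types (u w : nat -> V) (x y : V -> R[i]).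

Definition form_cauchy u := forall e : R, 0 < e -> exists N, forall m k,
  (N <= m)%N -> (N <= k)%N -> q (u m - u k) < e.

Lemma form_cauchy_lin a u w :
  form_cauchy u -> form_cauchy w -> form_cauchy (fun n => a *: u n + w n).
Proof.
move=> cu cw e e0; pose c := complex.Re a ^+ 2 + complex.Im a ^+ 2.
have c0 : 0 <= c by rewrite addr_ge0 ?sqr_ge0.
have [|N NP] := cu (e / 4 / (c + 1)); first by rewrite !divr_gt0 //; lra.
have [|M MP] := cw (e / 4); first by lra.
exists (maxn N M) => m k; rewrite !geq_max => /andP[Nm Mm] /andP[Nk Mk].
have -> : a *: u m + w m - (a *: u k + w k) = a *: (u m - u k) + (w m - w k).
  by rewrite scalerBr opprD addrACA.
apply: le_lt_trans (sqD_le FB _ _) _; rewrite (sqZ FB) -/c.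
have := NP _ _ Nm Nk; have := MP _ _ Mm Mk; have := sq_ge0 FB (u m - u k).
move: (q _) (q _) => s t s0 t0; rewrite ltr_pdivlMr; last by lra.
by lra.
Qed.

Lemma form_cauchyD u w :
  form_cauchy u -> form_cauchy w -> form_cauchy (fun n => u n + w n).
Proof.
move=> cu cw; have := form_cauchy_lin 1 cu cw.
by congr form_cauchy; apply/funext => n; rewrite scale1r.
Qed.

Lemma form_cauchy_cst v : form_cauchy (fun=> v).
Proof. by move=> e e0; exists 0%N => *; rewrite subrr (sq0 FB). Qed.

Lemma sqrt_sq_dist v v' : (Num.sqrt (q v) - Num.sqrt (q v')) ^+ 2 <= q (v - v').
Proof.
have v0 := sq_ge0 FB v; have v0' := sq_ge0 FB v'.
rewrite sqrrB !sqr_sqrtr // (sqB FB).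
suff : r v v' <= Num.sqrt (q v) * Num.sqrt (q v') by lra.
have [n0|p0] := leP (r v v') 0.
  by apply: le_trans n0 _; rewrite mulr_ge0 ?sqrtr_ge0.
rewrite -(@ler_pXn2r _ 2) ?nnegrE ?mulr_ge0 ?sqrtr_ge0 ?(ltW p0) // exprMn !sqr_sqrtr //.
exact: (re_CS FB).
Qed.

Lemma cvg_sq_of_sqrt u (l : R) : ((fun n => Num.sqrt (q (u n))) @ \oo --> l)%classic ->
  ((fun n => q (u n)) @ \oo --> l ^+ 2)%classic.
Proof.
move=> h.
have -> : (fun n => q (u n)) = (fun n => Num.sqrt (q (u n)) * Num.sqrt (q (u n))).
  by apply/funext => n; rewrite -expr2 sqr_sqrtr // (sq_ge0 FB).
by rewrite expr2; exact: cvgM.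
Qed.

Lemma form_cauchy_sq u : form_cauchy u ->
  exists l : R, ((fun n => q (u n)) @ \oo --> l)%classic.
Proof.
move=> cu; have [|l lP] := @real_cauchy _ (fun n => Num.sqrt (q (u n))).
  move=> e /cu[N NP]; exists N => m k Nm Nk.
  exact: le_lt_trans (sqrt_sq_dist _ _) (NP _ _ Nm Nk).
by exists (l ^+ 2); exact: cvg_sq_of_sqrt.
Qed.

Lemma re_polar v v' : r v v' = 2^-1 * (q (v + v') - q v - q v').
Proof. by rewrite (sqD FB); field. Qed.

Lemma cvg_re_polar u w (l a b : R) :
  ((fun n => q (u n + w n)) @ \oo --> l)%classic ->
  ((fun n => q (u n)) @ \oo --> a)%classic ->
  ((fun n => q (w n)) @ \oo --> b)%classic ->
  ((fun n => r (u n) (w n)) @ \oo --> (2^-1 * (l - a - b)))%classic.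
Proof.
move=> lP aP bP; under eq_fun do rewrite re_polar.
by apply: cvgM; [exact: cvg_cst|apply: cvgB; [exact: cvgB|]].
Qed.

Lemma form_cauchy_re u w : form_cauchy u -> form_cauchy w ->
  exists l : R, ((fun n => r (u n) (w n)) @ \oo --> l)%classic.
Proof.
move=> cu cw; have [a aP] := form_cauchy_sq cu; have [b bP] := form_cauchy_sq cw.
have [l lP] := form_cauchy_sq (form_cauchyD cu cw).
by exists (2^-1 * (l - a - b)); exact: cvg_re_polar.
Qed.

(** Expand [q (u n - u N) = q (u n) - 2 * r (u n) (u N) + q (u N)]: the cross term tends to 0, so a
    positive limit [l] of [q (u n)] would keep the distance to [u N] from becoming smaller than
    [l / 2]. This is why a point of the completion can be identified with the functional that it
    defines. *)
Lemma form_cauchy_null u : form_cauchy u ->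
  (forall v, ((fun n => r (u n) v) @ \oo --> (0 : R))%classic) ->
  ((fun n => q (u n)) @ \oo --> (0 : R))%classic.
Proof.
move=> cu u0; have [l lP] := form_cauchy_sq cu.
suff -> : 0 = l by [].
apply/eqP; rewrite eq_le; apply/andP; split.
  apply: (tends_le (@tends_cst R 0) lP).
  by exists 0%N => n _; exact: (sq_ge0 FB).
rewrite leNgt; apply/negP => l0.
have l2 : 0 < l / 2 by lra.
have [N NP] := cu _ l2.
have h : ((fun n => q (u n - u N)) @ \oo --> (l - 2 * 0 + q (u N)))%classic.
  under eq_fun do rewrite (sqB FB).
  apply: cvgD; last exact: cvg_cst.
  by apply: cvgB => //; apply: cvgM => //; exact: cvg_cst.
suff : l - 2 * 0 + q (u N) <= l / 2 by have := sq_ge0 FB (u N); lra.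
apply: (tends_le h (@tends_cst R _)); exists N => n Nn.
by apply/ltW/NP.
Qed.

End FormCauchy.

(** * Completion of a semi-inner product space *)

Section Completion.
Variables (R : realType) (V : lmodType R[i]) (B : V -> V -> R[i]) (FB : form B).
Local Notation r := (re B).
Local Notation q := (sq B).

(* [x v] stands for the inner product of the limit of [u] with [v]. *)
Definition represents (u : nat -> V) (x : V -> R[i]) : Prop :=
  [/\ form_cauchy B u,
      forall v, ((fun n => r (u n) v) @ \oo --> complex.Re (x v))%classic
    & forall v, complex.Im (x v) = complex.Re (x ('i%C *: v))].

Lemma represents_N u x v : represents u x ->
  complex.Re (x ('i%C *: ('i%C *: v))) = - complex.Re (x v).
Proof.
case=> _ h _; apply: (tends_uniq (h _)).
have -> : (fun n => r (u n) ('i%C *: ('i%C *: v))) = (fun n => - r (u n) v).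
  by apply/funext => n; rewrite scalerA -expr2 sqr_i scaleN1r (reNr FB).
exact: cvgN.
Qed.

Lemma represents_lin a u w x y : represents u x -> represents w y ->
  represents (fun n => a *: u n + w n) (a *: x + y).
Proof.
move=> ux wy; case: (ux) (wy) => cu hu iu [cw hw iw]; split.
- exact: form_cauchy_lin.
- move=> v.
  have -> : (fun n => r (a *: u n + w n) v) =
      (fun n => complex.Re a * r (u n) v - complex.Im a * r (u n) ('i%C *: v) + r (w n) v).
    apply/funext => n; rewrite (reDl FB) /re (formZl FB) (formZr FB).
    by case: a (B (u n) v) => a1 a2 [b1 b2] /=; ring.
  have -> : complex.Re ((a *: x + y) v) = complex.Re a * complex.Re (x v)
      - complex.Im a * complex.Re (x ('i%C *: v)) + complex.Re (y v).
    by rewrite -iu /= -[(a *: x + y) v]/(a * x v + y v);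
      case: a (x v) (y v) => a1 a2 [b1 b2] [c1 c2] /=.
  apply: cvgD; last exact: hw.
  by apply: cvgB; apply: cvgM; (exact: cvg_cst || exact: hu).
- move=> v; rewrite -![(a *: x + y) _]/(a * x _ + y _) !raddfD /= iw; congr (_ + _).
  have := represents_N v ux; have := iu ('i%C *: v); have := iu v.
  case: a (x v) (x ('i%C *: v)) => a1 a2 [b1 b2] [c1 c2] /= -> -> ->; ring.
Qed.

Lemma represents_exists u : form_cauchy B u -> exists x, represents u x.
Proof.
move=> cu.
have h v := form_cauchy_re FB cu (form_cauchy_cst FB v).
have [f fP] := choice h.
exists (fun v => (f v +i* f ('i%C *: v))%C); split => // v; exact: fP.
Qed.

Lemma represents_cst v : represents (fun=> v) (fun w => B v w).
Proof.
split; first exact: form_cauchy_cst.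
  by move=> w; exact: cvg_cst.
by move=> w; rewrite -(re_ir FB).
Qed.

(** The proof of [form B] is an argument so that the submodule instance, whose closure properties
    depend on it, can be attached to the predicate. *)
Definition completion_pred of form B : {pred V -> R[i]} :=
  fun x => `[< exists u, represents u x >].

Lemma completion_submod : submod_closed (completion_pred FB).
Proof.
split=> [|a x y /asboolP[u ux] /asboolP[w wy]].
  apply/asboolP; exists (fun=> 0); have := represents_cst 0.
  by congr represents; apply/funext => w; rewrite (form0l FB).
by apply/asboolP; exists (fun n => a *: u n + w n); exact: represents_lin.
Qed.

HB.instance Definition _ :=
  GRing.isSubmodClosed.Build R[i] (V -> R[i]) (completion_pred FB) completion_submod.

(** Points are functionals on [V] instead of classes of Cauchy sequences: equality is then equality
    of functions, and null vectors of [B] are identified without a quotient. *)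
Record completion (F : form B) :=
  Completion { cval :> V -> R[i]; _ : cval \in completion_pred F }.

HB.instance Definition _ := [isSub for (@cval FB)].
HB.instance Definition _ := [Choice of completion FB by <:].
HB.instance Definition _ := [SubChoice_isSubLmodule of completion FB by <:].

Local Notation H := (completion FB).
Implicit Types x y z : H.

Lemma completion_rep x : exists u, represents u (val x).
Proof. by case: x => x; exact: asboolP. Qed.

Lemma completion_of u f : represents u f -> exists x : H, val x = f.
Proof.
move=> uf; have fP : f \in completion_pred FB by apply/asboolP; exists u.
by exists (Completion fP).
Qed.

(** Two sequences representing the same functional differ by a Cauchy sequence that is weakly null,
    hence null by [form_cauchy_null]. Square roots are compared because they are 1-Lipschitz for the
    seminorm. *)
Lemma represents_sq_lim x : exists l : R, forall u, represents u (val x) ->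
  ((fun n => q (u n)) @ \oo --> l)%classic.
Proof.
have [u ux] := completion_rep x; have [cu _ _] := ux.
have [|l lP] := @real_cauchy _ (fun n => Num.sqrt (q (u n))).
  move=> e /cu[N NP]; exists N => m k Nm Nk.
  exact: le_lt_trans (sqrt_sq_dist FB _ _) (NP _ _ Nm Nk).
exists (l ^+ 2) => w wx; apply: (cvg_sq_of_sqrt FB).
have d : represents (fun n => (-1) *: u n + w n) ((-1) *: val x + val x).
  exact: represents_lin.
have [cd hd _] := d.
have := form_cauchy_null FB cd; rewrite scaleN1r addNr in hd => /(_ hd) d0.
have e0 : ((fun n => Num.sqrt (q (w n)) - Num.sqrt (q (u n))) @ \oo --> (0 : R))%classic.
  apply: tends_sqr0; apply: (tends_squeeze0 _ d0) => n.
  by rewrite sqr_ge0 /= scaleN1r [- u n + _]addrC (sqrt_sq_dist FB).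
have -> : (fun n => Num.sqrt (q (w n))) =
    (fun n => (Num.sqrt (q (w n)) - Num.sqrt (q (u n))) + Num.sqrt (q (u n))).
  by apply/funext => n; rewrite subrK.
by rewrite -[l]add0r; exact: cvgD.
Qed.

Definition completion_sq x : R := projT1 (cid (represents_sq_lim x)).

Definition completion_re x y : R :=
  2^-1 * (completion_sq (x + y) - completion_sq x - completion_sq y).

Lemma completion_reP x y u w : represents u (val x) -> represents w (val y) ->
  ((fun n => r (u n) (w n)) @ \oo --> completion_re x y)%classic.
Proof.
have h z v : represents v (val z) -> ((fun n => q (v n)) @ \oo --> completion_sq z)%classic.
  by rewrite /completion_sq; case: cid => l /= /(_ v).
move=> ux wy; apply: (cvg_re_polar FB); try exact: h.
apply: h; rewrite raddfD /=; have := represents_lin 1 ux wy.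
by rewrite scale1r; congr represents; apply/funext => n; rewrite scale1r.
Qed.

Lemma represents_scale a x u : represents u (val x) ->
  represents (fun n => a *: u n) (val (a *: x)).
Proof.
move=> ux; have := represents_lin a ux (represents_cst 0).
rewrite (_ : (fun w => B 0 w) = 0); last first.
  by apply/funext => w; rewrite (form0l FB).
by rewrite addr0; congr represents; apply/funext => n; rewrite addr0.
Qed.

Definition completion_inner x y : R[i] :=
  (completion_re x y +i* completion_re x ('i%C *: y))%C.

Lemma completion_form : form completion_inner.
Proof.
apply: form_of_real.
- move=> x y z; have [u ux] := completion_rep x; have [w wy] := completion_rep y.
  have [t tz] := completion_rep z.
  have uw : represents (fun n => u n + w n) (val (x + y)).
    rewrite raddfD /=; have := represents_lin 1 ux wy.
    by rewrite scale1r; congr represents; apply/funext => n; rewrite scale1r.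
  apply: (tends_uniq (completion_reP uw tz)).
  under eq_fun do rewrite (reDl FB).
  by apply: cvgD; exact: completion_reP.
- move=> s x y; have [u ux] := completion_rep x; have [w wy] := completion_rep y.
  apply: (tends_uniq (completion_reP (represents_scale s%:C%C ux) wy)).
  under eq_fun do rewrite (reZl FB).
  by apply: cvgM; [exact: cvg_cst|exact: completion_reP].
- move=> x y; have [u ux] := completion_rep x; have [w wy] := completion_rep y.
  apply: (tends_uniq (completion_reP ux wy)).
  under eq_fun do rewrite (reC FB).
  exact: completion_reP.
- move=> x y; have [u ux] := completion_rep x; have [w wy] := completion_rep y.
  apply: (tends_uniq (completion_reP (represents_scale 'i%C ux) (represents_scale 'i%C wy))).
  have -> : (fun n => r ('i%C *: u n) ('i%C *: w n)) = (fun n => r (u n) (w n)).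
    apply/funext => n; rewrite /re (formZl FB) (formZr FB).
    by case: (B _ _) => a b /=; ring.
  exact: completion_reP.
- move=> x; have [u ux] := completion_rep x.
  apply: (tends_le (@tends_cst R 0) (completion_reP ux ux)).
  by exists 0%N => n _; exact: (sq_ge0 FB).
Qed.

Lemma completion_sqP x u : represents u (val x) ->
  ((fun n => q (u n)) @ \oo --> sq completion_inner x)%classic.
Proof. by move=> ux; exact: completion_reP. Qed.

Lemma completion_definite x : completion_inner x x = 0 -> x = 0.
Proof.
have [u ux] := completion_rep x; have [cu hu iu] := ux.
move=> x0; have := completion_sqP ux; rewrite /sq x0 /= => q0.
have rex v : complex.Re (val x v) = 0.
  apply: (tends_uniq (hu v)); apply: tends_sqr0.
  apply: (@tends_squeeze0 _ _ (fun n => q (u n) * q v)).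
    by move=> n; rewrite sqr_ge0 (re_CS FB).
  by rewrite -(mul0r (q v)); apply: cvgM => //; exact: cvg_cst.
apply: val_inj => /=; apply/funext => v; apply/eqP.
by rewrite eq_complex iu !rex /= !eqxx.
Qed.

Lemma completion_embed_exists v : exists x : H, val x = (fun w => B v w).
Proof. exact: completion_of (represents_cst v). Qed.

Definition completion_embed v : H := projT1 (cid (completion_embed_exists v)).
Local Notation iota := completion_embed.

Lemma completion_embedE v : val (iota v) = (fun w => B v w).
Proof. by rewrite /iota; case: cid. Qed.

Lemma completion_embed_rep v : represents (fun=> v) (val (iota v)).
Proof. by rewrite completion_embedE; exact: represents_cst. Qed.

Lemma completion_embed_lin a u v : iota (a *: u + v) = a *: iota u + iota v.
Proof.
apply: val_inj; rewrite raddfD /= !completion_embedE.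
by apply/funext => w; rewrite (formDl FB) (formZl FB).
Qed.

Lemma completion_inner_embed x v : completion_inner x (iota v) = val x v.
Proof.
have [u ux] := completion_rep x; have [cu hu iu] := ux.
have h w : completion_re x (iota w) = complex.Re (val x w).
  exact: (tends_uniq (completion_reP ux (completion_embed_rep w)) (hu w)).
have -> : completion_inner x (iota v) =
    (completion_re x (iota v) +i* completion_re x (iota ('i%C *: v)))%C.
  rewrite /completion_inner; congr (_ +i* completion_re x _)%C.
  have i0 : iota 0 = 0.
    by have := completion_embed_lin (-1) 0 0; rewrite scaler0 addr0 scaleN1r addNr.
  by have := completion_embed_lin 'i%C v 0; rewrite addr0 i0 addr0.
by rewrite !h -iu; case: (val x v).
Qed.

Lemma completion_dense_rep x u : represents u (val x) ->
  forall e : R, 0 < e -> exists N, forall k, (N <= k)%N ->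
    sq completion_inner (x - iota (u k)) < e.
Proof.
move=> ux e e0; have [cu _ _] := ux.
have [|N NP] := cu (e / 2); first by lra.
exists N => k Nk.
have d : represents (fun n => - u k + u n) (val (x - iota (u k))).
  have h := represents_lin (-1) (completion_embed_rep (u k)) ux.
  by rewrite addrC; rewrite !scaleN1r in h; exact: h.
apply: (@le_lt_trans _ _ (e / 2)); last by lra.
apply: (tends_le (completion_sqP d) (@tends_cst R _)).
by exists N => n Nn; rewrite addrC; apply/ltW/NP.
Qed.

Lemma completion_complete (X : nat -> H) : form_cauchy completion_inner X ->
  exists x : H, forall e : R, 0 < e -> exists N, forall k, (N <= k)%N ->
    sq completion_inner (X k - x) < e.
Proof.
move=> cX; have FH := completion_form.
have ex k : exists v, sq completion_inner (X k - iota v) < (k.+1%:R)^-1.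
  have [u uX] := completion_rep (X k).
  have [|N NP] := completion_dense_rep uX (e := (k.+1%:R)^-1).
    by rewrite invr_gt0.
  by exists (u N); exact: NP.
have [v vP] := choice ex.
have sq_embed w : sq completion_inner (iota w) = q w.
  exact: (tends_uniq (completion_sqP (completion_embed_rep w)) (@tends_cst R _)).
have embedB w w' : iota (w - w') = iota w - iota w'.
  by have := completion_embed_lin (-1) w' w; rewrite !scaleN1r addrC [- _ + _]addrC.
have cv : form_cauchy B v.
  (* Splitting the difference into three terms costs the weights 4, 4 and 2 on their squares, a
     total of [10 * (e / 16)]. *)
  move=> e e0; have [|N NP] := cX (e / 16); first by lra.
  have [|M MP] := @invS_lt R (e / 16); first by lra.
  exists (maxn N M) => m k; rewrite !geq_max => /andP[Nm Mm] /andP[Nk Mk].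
  rewrite -sq_embed embedB.
  have -> : iota (v m) - iota (v k) =
      (X k - iota (v k) + (X m - X k)) - (X m - iota (v m)).
    by rewrite [_ + (X m - X k)]addrC addrA subrK opprB [RHS]addrC addrA subrK.
  apply: le_lt_trans (sqB_le FH _ _) _.
  have := sqD_le FH (X k - iota (v k)) (X m - X k).
  have := lt_trans (vP m) (MP _ Mm); have := lt_trans (vP k) (MP _ Mk).
  have := NP _ _ Nm Nk; lra.
have [f fP] := represents_exists cv.
have [x xf] := completion_of fP; exists x => e e0.
rewrite -xf in fP.
have [|N NP] := completion_dense_rep fP (e := e / 4); first by lra.
have [|M MP] := @invS_lt R (e / 4); first by lra.
exists (maxn N M) => k; rewrite geq_max => /andP[Nk Mk].
have -> : X k - x = (X k - iota (v k)) - (x - iota (v k)).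
  by rewrite opprB addrA subrK.
apply: le_lt_trans (sqB_le FH _ _) _.
have := NP _ Nk; have := lt_trans (vP k) (MP _ Mk); lra.
Qed.

End Completion.

Lemma completion_theorem (R : realType) (V : lmodType R[i]) (B : V -> V -> R[i]) :
  form B ->
  exists (H : hilbert R) (iota : V -> H),
  [/\ forall a u v, iota (a *: u + v) = a *: iota u + iota v,
      forall u v, hinner (iota u) (iota v) = B u v
    & forall x : H, (forall v, hinner x (iota v) = 0) -> x = 0].
Proof.
move=> FB.
have [hl hs hp] := completion_form FB.
pose H := Hilbert hl hs hp (@completion_definite _ _ _ FB) (@completion_complete _ _ _ FB).
exists H, (completion_embed FB : V -> H); split.
- exact: completion_embed_lin.
- by move=> u v; rewrite [hinner _ _]completion_inner_embed completion_embedE.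
- move=> x x0; apply: val_inj; apply/funext => v /=.
  by rewrite -completion_inner_embed; exact: x0.
Qed.

(** * Hilbert space tools *)

Section HilbertTools.
Variables (R : realType) (H : hilbert R).
Local Notation r := (re (@hinner R H)).
Local Notation q := (sq (@hinner R H)).

Lemma hinner_ext (x y : H) : (forall z, hinner x z = hinner y z) -> x = y.
Proof.
move=> h; apply/eqP; rewrite -subr_eq0; apply/eqP; apply: hinner_eq0.
by rewrite -scaleN1r addrC (formDl (hform H)) (formZl (hform H)) h mulN1r addNr.
Qed.

Lemma hinner_eq0C (x y : H) : hinner x y = 0 -> hinner y x = 0.
Proof. by rewrite [hinner y x]hinner_sym conj_conjc => ->; rewrite rmorph0. Qed.

(** Riesz representation of [hinner x] restricted to [P]. Since [P] need not be closed, [p] is only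
    a limit of its elements. *)
Lemma projection (P : H -> Prop) : P 0 ->
  (forall a u v, P u -> P v -> P (a *: u + v)) -> forall x : H, exists p : H,
  (forall e : R, 0 < e -> exists v, P v /\ q (p - v) < e) /\
  (forall v, P v -> hinner (x - p) v = 0).
Proof.
move=> P0 PP x; have FH := hform H.
have phiP a u v : hinner x (a *: u + v) = conjc a * hinner x u + hinner x v.
  by rewrite (formDr FH) (formZr FH).
have phi_le v : P v -> complex.Re (hinner x v) ^+ 2 <= q x * q v.
  by move=> _; exact: (re_CS FH).
have [p [h1 h2]] := @riesz_min R H H P id (hinner x) (q x)
  (fun=> fun=> fun=> erefl) phiP P0 PP (sq_ge0 FH x) phi_le.
exists p; split => // v Pv.
by rewrite (formDl FH) -(h2 _ Pv) -scaleN1r (formZl FH) mulN1r subrr.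
Qed.

Lemma riesz_dense (V : lmodType R[i]) (iota : V -> H) (phi : V -> R[i]) (c : R) :
  (forall a u v, iota (a *: u + v) = a *: iota u + iota v) ->
  (forall a u v, phi (a *: u + v) = conjc a * phi u + phi v) ->
  0 <= c -> (forall v, complex.Re (phi v) ^+ 2 <= c * q (iota v)) ->
  exists y : H, (forall e : R, 0 < e -> exists v, q (y - iota v) < e) /\
    forall v, hinner y (iota v) = phi v.
Proof.
move=> iotaP phiP c0 h.
have [|y [y1 y2]] := @riesz_min R H V (fun=> True) iota phi c
  iotaP phiP I (fun=> fun=> fun=> fun=> fun=> I) c0.
  by move=> v _; exact: h.
exists y; split => [e /y1[v [_ ?]]|v]; first by exists v.
exact: y2.
Qed.

Lemma hinner_small0 (y z : H) :
  (forall e : R, 0 < e -> exists v, q (y - v) < e /\ hinner v z = 0) ->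
  hinner y z = 0.
Proof.
move=> h; have FH := hform H.
(* Stated for every [z'] whose orthogonality follows from that of [z], so that it serves both [z]
   and ['i *: z] and gives both parts of the inner product. *)
have key : forall z', (forall v, hinner v z = 0 -> hinner v z' = 0) -> r y z' = 0.
  move=> z' zz'; apply/eqP; rewrite -sqrf_eq0 eq_le sqr_ge0 andbT.
  apply: (@le0_of_small _ _ (q z')) => e /h[v [yv vz]].
  have -> : r y z' = r (y - v) z'.
    by rewrite (reBl FH) /re (zz' v vz) subr0.
  by apply: le_trans (re_CS FH _ _) _; rewrite ler_wpM2r ?(sq_ge0 FH) ?ltW.
rewrite (form_re FH) !key // => v vz; by rewrite (formZr FH) vz mulr0.
Qed.

Lemma dense_of_orth0 (V : lmodType R[i]) (iota : V -> H) :
  (forall a u v, iota (a *: u + v) = a *: iota u + iota v) ->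
  (forall x : H, (forall v, hinner x (iota v) = 0) -> x = 0) ->
  forall (x : H) (e : R), 0 < e -> exists v, q (x - iota v) < e.
Proof.
move=> iotaP h x; have FH := hform H.
have phiP a u v : hinner x (iota (a *: u + v)) =
    conjc a * hinner x (iota u) + hinner x (iota v).
  by rewrite iotaP (formDr FH) (formZr FH).
have phi_le v : complex.Re (hinner x (iota v)) ^+ 2 <= q x * q (iota v).
  exact: (re_CS FH).
have [y [y1 y2]] := riesz_dense iotaP phiP (sq_ge0 FH x) phi_le.
suff -> : x = y by [].
apply/eqP; rewrite -subr_eq0; apply/eqP; apply: h => v.
by rewrite (formDl FH) -y2 -scaleN1r (formZl FH) mulN1r subrr.
Qed.

Lemma orth0_of_dense (V : Type) (iota : V -> H) :
  (forall (x : H) (e : R), 0 < e -> exists v, q (x - iota v) < e) ->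
  forall x : H, (forall v, hinner x (iota v) = 0) -> x = 0.
Proof.
move=> h x x0; have FH := hform H; apply: sq_le0.
apply: (@le0_of_small _ _ 1) => e /(h x)[v xv].
have := sq_ge0 FH (iota v); move: xv; rewrite (sqB FH) /re x0 /=; lra.
Qed.

End HilbertTools.

(** * Extension of densely defined isometries *)

Section Isometry.
Variables (R : realType) (V : lmodType R[i]).

(** [U] is the adjoint of the isometry [iota2 v |-> iota1 v], hence a contraction. No density is
    assumed: [U x] is chosen in the closure of the range of [iota2], and this choice yields the norm
    bound. *)
Lemma dense_transfer (H1 H2 : hilbert R) (iota1 : V -> H1) (iota2 : V -> H2) :
  (forall a u v, iota1 (a *: u + v) = a *: iota1 u + iota1 v) ->
  (forall a u v, iota2 (a *: u + v) = a *: iota2 u + iota2 v) ->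
  (forall v, sq (@hinner R H1) (iota1 v) = sq (@hinner R H2) (iota2 v)) ->
  exists U : H1 -> H2,
    (forall x v, hinner (U x) (iota2 v) = hinner x (iota1 v)) /\
    (forall x, sq (@hinner R H2) (U x) <= sq (@hinner R H1) x).
Proof.
move=> l1 l2 h12; have F1 := hform H1; have F2 := hform H2.
suff ex x : exists y : H2, (forall v, hinner y (iota2 v) = hinner x (iota1 v)) /\
    sq (@hinner R H2) y <= sq (@hinner R H1) x.
  have [U UP] := choice ex.
  by exists U; split=> [x|x]; have [] := UP x.
have phiP a u v : hinner x (iota1 (a *: u + v)) =
    conjc a * hinner x (iota1 u) + hinner x (iota1 v).
  by rewrite l1 (formDr F1) (formZr F1).
have phi_le v : complex.Re (hinner x (iota1 v)) ^+ 2
    <= sq (@hinner R H1) x * sq (@hinner R H2) (iota2 v).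
  by rewrite -h12; exact: (re_CS F1).
have [y [y1 y2]] := riesz_dense l2 phiP (sq_ge0 F1 x) phi_le.
exists y; split => //; apply: (@le_of_small _ _ _ 1) => e /y1[v].
rewrite (sqB F2) /re y2 -h12 => h.
have := re_le F1 x (iota1 v); rewrite /re; lra.
Qed.

(** Transfer in both directions. Density makes the two maps mutually inverse, and contractions with
    contractive inverses are isometric. *)
Lemma dense_isometry (H1 H2 : hilbert R) (iota1 : V -> H1) (iota2 : V -> H2) :
  (forall a u v, iota1 (a *: u + v) = a *: iota1 u + iota1 v) ->
  (forall a u v, iota2 (a *: u + v) = a *: iota2 u + iota2 v) ->
  (forall x : H1, (forall v, hinner x (iota1 v) = 0) -> x = 0) ->
  (forall x : H2, (forall v, hinner x (iota2 v) = 0) -> x = 0) ->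
  (forall v, sq (@hinner R H1) (iota1 v) = sq (@hinner R H2) (iota2 v)) ->
  exists U : H1 -> H2, unitary U /\ forall v, U (iota1 v) = iota2 v.
Proof.
move=> l1 l2 d1 d2 h12; have F1 := hform H1; have F2 := hform H2.
have [U [UP Ule]] := dense_transfer l1 l2 h12.
have [U' [UP' Ule']] := dense_transfer l2 l1 (fun v => esym (h12 v)).
have ext1 x y : (forall v, hinner x (iota1 v) = hinner y (iota1 v)) -> x = y.
  move=> h; apply/eqP; rewrite -subr_eq0; apply/eqP; apply: d1 => v.
  by rewrite (formDl F1) h -scaleN1r (formZl F1) mulN1r subrr.
have ext2 x y : (forall v, hinner x (iota2 v) = hinner y (iota2 v)) -> x = y.
  move=> h; apply/eqP; rewrite -subr_eq0; apply/eqP; apply: d2 => v.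
  by rewrite (formDl F2) h -scaleN1r (formZl F2) mulN1r subrr.
have K1 x : U' (U x) = x by apply: ext1 => v; rewrite UP' UP.
have K2 x : U (U' x) = x by apply: ext2 => v; rewrite UP UP'.
have Ulin a x y : U (a *: x + y) = a *: U x + U y.
  by apply: ext2 => v; rewrite UP (formDl F1) (formDl F2) (formZl F1) (formZl F2) !UP.
have Uq x : sq (@hinner R H2) (U x) = sq (@hinner R H1) x.
  by apply/eqP; rewrite eq_le Ule /= -{1}(K1 x) Ule'.
have gram u v : re (@hinner R H1) u v = re (@hinner R H2) (U u) (U v).
  rewrite (re_polar F1) (re_polar F2) -(Uq (u + v)) -!Uq.
  by rewrite -{1}[u]scale1r Ulin scale1r.
have U0 : U 0 = 0.
  by have := Ulin (-1) 0 0; rewrite scaler0 addr0 scaleN1r addNr.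
exists U; split; last first.
  move=> v; apply: ext2 => w; rewrite UP.
  have g x y : re (@hinner R H1) (iota1 x) (iota1 y) =
      re (@hinner R H2) (iota2 x) (iota2 y).
    have D1 : iota1 x + iota1 y = iota1 (x + y).
      by rewrite -[x in RHS]scale1r l1 scale1r.
    have D2 : iota2 x + iota2 y = iota2 (x + y).
      by rewrite -[x in RHS]scale1r l2 scale1r.
    by rewrite (re_polar F1) (re_polar F2) D1 D2 !h12.
  have Z1 : 'i%C *: iota1 w = iota1 ('i%C *: w).
    have z0 : iota1 0 = 0.
      by have := l1 (-1) 0 0; rewrite scaler0 addr0 scaleN1r addNr.
    by rewrite -[_ *: w]addr0 l1 z0 addr0.
  have Z2 : 'i%C *: iota2 w = iota2 ('i%C *: w).
    have z0 : iota2 0 = 0.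
      by have := l2 (-1) 0 0; rewrite scaler0 addr0 scaleN1r addNr.
    by rewrite -[_ *: w]addr0 l2 z0 addr0.
  by rewrite (form_re F1) (form_re F2) Z1 Z2 !g.
split => // [x y|z]; last by exists (U' z); exact: K2.
have UZ : 'i%C *: U y = U ('i%C *: y) by rewrite -[_ *: y]addr0 Ulin U0 addr0.
by rewrite (form_re F1) (form_re F2) UZ !gram.
Qed.

End Isometry.

(** * The orthogonal complement as a Hilbert space *)

Section OrthogonalComplement.
Variables (R : realType) (H : hilbert R) (D : H -> Prop).
Local Notation q := (sq (@hinner R H)).

Definition orth_pred : {pred H} := fun x => `[< forall d, D d -> hinner x d = 0 >].

Lemma orth_submod : submod_closed orth_pred.
Proof.
split=> [|a x y /asboolP hx /asboolP hy]; apply/asboolP => d Dd.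
  by rewrite (form0l (hform H)).
by rewrite (formDl (hform H)) (formZl (hform H)) hx // hy // mulr0 addr0.
Qed.

HB.instance Definition _ := GRing.isSubmodClosed.Build R[i] H orth_pred orth_submod.

Record orth := Orth { orth_val :> H; _ : orth_val \in orth_pred }.
HB.instance Definition _ := [isSub for orth_val].
HB.instance Definition _ := [Choice of orth by <:].
HB.instance Definition _ := [SubChoice_isSubLmodule of orth by <:].

Definition orth_inner (x y : orth) : R[i] := hinner (val x) (val y).

Lemma orth_linear a (x y z : orth) :
  orth_inner (a *: x + y) z = a * orth_inner x z + orth_inner y z.
Proof. by rewrite /orth_inner raddfD /= (formDl (hform H)) -(formZl (hform H)). Qed.

Lemma orth_sym (x y : orth) : orth_inner y x = (orth_inner x y)^*.
Proof. exact: hinner_sym. Qed.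

Lemma orth_inner_ge0 (x : orth) : 0 <= orth_inner x x.
Proof. exact: hinner_ge0. Qed.

Lemma orth_inner_eq0 (x : orth) : orth_inner x x = 0 -> x = 0.
Proof. by move=> /hinner_eq0 x0; exact: val_inj. Qed.

Lemma orth_complete (u : nat -> orth) :
  (forall e : R, 0 < e -> exists N : nat, forall m k : nat,
     (N <= m)%N -> (N <= k)%N ->
     complex.Re (orth_inner (u m - u k) (u m - u k)) < e) ->
  exists x : orth, forall e : R, 0 < e -> exists N : nat, forall k : nat,
    (N <= k)%N -> complex.Re (orth_inner (u k - x) (u k - x)) < e.
Proof.
move=> cu; have [|x xP] := @hcomplete _ H (fun k => val (u k)).
  by move=> e /cu[N NP]; exists N => m k Nm Nk; have := NP _ _ Nm Nk;
     rewrite /orth_inner raddfB.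
have xO : x \in orth_pred.
  apply/asboolP => d Dd; apply: (@hinner_small0 _ _ _ _) => e /xP[N NP].
  exists (val (u N)); split.
    by rewrite (sqBC (hform H)); exact: NP.
  by case: (u N) => y /= /asboolP; exact.
exists (Orth xO) => e /xP[N NP]; exists N => k /NP.
by rewrite /orth_inner raddfB.
Qed.

Lemma orth_hilbert : exists (G : hilbert R) (j : G -> H),
  [/\ forall a x y, j (a *: x + y) = a *: j x + j y,
      forall x y, hinner (j x) (j y) = hinner x y,
      forall g d, D d -> hinner (j g) d = 0
    & forall x, (forall d, D d -> hinner x d = 0) -> exists g, j g = x].
Proof.
exists (Hilbert orth_linear orth_sym orth_inner_ge0 orth_inner_eq0 orth_complete).
exists (val : orth -> H); split.
- by move=> a x y; rewrite raddfD.
- by [].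
- by case=> x /= /asboolP xP d; exact: xP.
- by move=> x xO; exists (Orth (introT (asboolP _) xO)).
Qed.

End OrthogonalComplement.

(** * The space of square summable functions on words *)

Lemma ler_sum_sub (R : realType) (T : eqType) (s t : seq T) (h : T -> R) :
  uniq s -> uniq t -> {subset s <= t} -> (forall w, 0 <= h w) ->
  \sum_(w <- s) h w <= \sum_(w <- t) h w.
Proof.
move=> us ut st h0.
have p : perm_eq s [seq w <- t | w \in s].
  apply: uniq_perm => // [|w]; first exact: filter_uniq.
  by rewrite mem_filter andb_idr //; exact: st.
rewrite (perm_big _ p) big_filter big_mkcond ler_sum // => w _.
by case: ifP.
Qed.

Section Words.
Variable n : option nat.

(** Enumeration by code gives one increasing sequence of finite sets exhausting the valid words, for
    every [n] including infinity; unordered sums over words become limits of sequences. *)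
Definition words (N : nat) : seq (seq nat) :=
  [seq w <- pmap pickle_inv (iota 0 N) | validw n w].

Lemma words_uniq N : uniq (words N).
Proof. by rewrite filter_uniq // (pmap_uniq (@pickle_invK _)) // iota_uniq. Qed.

Lemma words_valid N w : w \in words N -> validw n w.
Proof. by rewrite mem_filter => /andP[]. Qed.

Lemma mem_words N w : validw n w -> (pickle w < N)%N -> w \in words N.
Proof.
move=> vw wN; rewrite mem_filter vw mem_pmap -[Some w]pickleK_inv.
by rewrite map_f // mem_iota add0n leq0n.
Qed.

Lemma sub_words (s : seq (seq nat)) : {in s, forall w, validw n w} ->
  exists N, forall M, (N <= M)%N -> {subset s <= words M}.
Proof.
elim: s => [|w s IH] h; first by exists 0%N.
have [|N NP] := IH; first by move=> v vs; apply: h; rewrite inE vs orbT.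
exists (maxn N (pickle w).+1) => M; rewrite geq_max => /andP[NM wM] v.
rewrite inE => /orP[/eqP ->|/(NP _ NM)//].
by apply: mem_words => //; apply: h; rewrite inE eqxx.
Qed.

Lemma words_cat M N : (M <= N)%N -> exists s,
  [/\ words N = words M ++ s, uniq s & {in s, forall w, w \notin words M}].
Proof.
move=> MN; pose s := [seq w <- pmap pickle_inv (iota M (N - M)) | validw n w].
have e : words N = words M ++ s.
  by rewrite /words -{1}(subnKC MN) iotaD pmap_cat filter_cat.
exists s; split => //; have := words_uniq N; rewrite e cat_uniq.
  by case/and3P.
case/and3P => _ /hasPn h _ w /h.
by [].
Qed.

Lemma words_sub M N : (M <= N)%N -> {subset words M <= words N}.
Proof. by case/words_cat => s [-> _ _] w; rewrite mem_cat => ->. Qed.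

End Words.

(** * The Fock norm as a limit of partial sums *)

Section FockNorm.
Variables (R : realType) (n : option nat) (W : hilbert R).
Implicit Types f g : fock W.

Lemma hnormsq_ge0 (x : W) : 0 <= hnormsq x.
Proof. exact: (sq_ge0 (hform W)). Qed.

Definition psum f N : R := \sum_(w <- words n N) hnormsq (f w).

Lemma psum_mono f M N : (M <= N)%N -> psum f M <= psum f N.
Proof.
move=> MN; apply: ler_sum_sub; rewrite ?words_uniq //; first exact: words_sub.
by move=> w; exact: hnormsq_ge0.
Qed.

Lemma esum_words f N :
  ((psum f N)%:E <= fnormsqE n f)%E.
Proof.
apply: esum_ge; exists [set` words n N]%classic.
  by split; [exact: finite_seq | move=> w /= /words_valid].
by rewrite -fsbig_seq ?words_uniq // sumEFin.
Qed.

Lemma fnormsqE_le f (c : R) : (forall N, psum f N <= c) -> (fnormsqE n f <= c%:E)%E.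
Proof.
move=> h; apply: ge_ereal_sup => _ [F [finF FS] <-].
have [s sF] := (@finite_seqP _ F).1 finF.
have [|N NP] := @sub_words n s.
  by move=> w ws; apply: FS; rewrite sF.
rewrite sF; have -> : [set` s]%classic = [set` undup s]%classic.
  by apply/seteqP; split=> w /=; rewrite mem_undup.
rewrite -fsbig_seq ?undup_uniq // sumEFin lee_fin.
apply: le_trans (h N); apply: ler_sum_sub; rewrite ?undup_uniq ?words_uniq //.
  by move=> w; rewrite mem_undup; exact: NP.
by move=> w; exact: hnormsq_ge0.
Qed.

Lemma fnormsq_bound f (c : R) : (forall w, ~~ validw n w -> f w = 0) ->
  (forall N, psum f N <= c) -> inl2 n f /\ fnormsq n f <= c.
Proof.
move=> f0 /fnormsqE_le h.
have fin : (fnormsqE n f < +oo)%E by apply: le_lt_trans h _; rewrite ltry.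
split; first by split.
have nn : (0 <= fnormsqE n f)%E.
  by have := esum_words f 0; rewrite /psum big_nil.
by rewrite -lee_fin /fnormsq fineK // ge0_fin_numE.
Qed.

Lemma psum_le f N : inl2 n f -> psum f N <= fnormsq n f.
Proof.
case=> fin _; have nn : (0 <= fnormsqE n f)%E.
  by have := esum_words f 0; rewrite /psum big_nil.
by rewrite -lee_fin /fnormsq fineK ?ge0_fin_numE // esum_words.
Qed.

Lemma fnormsq_ge0 f : inl2 n f -> 0 <= fnormsq n f.
Proof. by move=> /(psum_le 0); rewrite /psum big_nil. Qed.

Lemma psum_cvg f : inl2 n f -> (psum f @ \oo --> fnormsq n f)%classic.
Proof.
move=> fl; apply/tendsP => e e0.
have [N eN] : exists N, fnormsq n f - e < psum f N.
  apply: contrapT => h; have [|_] := @fnormsq_bound f (fnormsq n f - e) fl.2.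
    by move=> N; rewrite leNgt; apply/negP => hN; apply: h; exists N.
  lra.
exists N => M NM; rewrite distrC ger0_norm ?subr_ge0 ?psum_le //.
by have := psum_mono f NM; lra.
Qed.

Lemma hnormsq_le_fnormsq f w : inl2 n f -> hnormsq (f w) <= fnormsq n f.
Proof.
move=> fl; case vw : (validw n w); last first.
  by rewrite fl.2 ?vw // /hnormsq (form0l (hform W)) fnormsq_ge0.
apply: le_trans (psum_le (pickle w).+1 fl).
rewrite /psum (bigD1_seq w) ?words_uniq ?mem_words //= lerDl sumr_ge0 // => v _.
exact: hnormsq_ge0.
Qed.

End FockNorm.

Section L2.
Variables (R : realType) (n : option nat) (W : hilbert R).

Definition l2_pred : {pred (seq nat -> W)} := fun f => `[< inl2 n f >].

Lemma l2_submod : submod_closed l2_pred.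
Proof.
have FW := hform W.
split=> [|a f g /asboolP fl /asboolP gl]; apply/asboolP.
  have [] // := @fnormsq_bound R n W 0 0 => // N.
  by rewrite /psum big1 // => w _; exact: (sq0 FW).
pose c := complex.Re a ^+ 2 + complex.Im a ^+ 2.
have [] // := @fnormsq_bound R n W (a *: (f : fock W) + g)
    (2 * (c * fnormsq n f + fnormsq n g)).
  by move=> w nw; rewrite -[LHS]/(a *: f w + g w) fl.2 // gl.2 // scaler0 addr0.
move=> N.
have c0 : 0 <= c by rewrite addr_ge0 ?sqr_ge0.
apply: le_trans (_ : 2 * (c * psum n f N + psum n g N) <= _).
  rewrite /psum !mulr_sumr -big_split /= mulr_sumr; apply: ler_sum => w _.
  apply: le_trans (sqD_le FW (a *: f w) (g w)) _.
  by rewrite (sqZ FW).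
by rewrite ler_wpM2l // lerD ?psum_le // ler_wpM2l ?psum_le.
Qed.

HB.instance Definition _ :=
  GRing.isSubmodClosed.Build R[i] (seq nat -> W) l2_pred l2_submod.

Record l2 := L2 { l2val :> seq nat -> W; _ : l2val \in l2_pred }.
HB.instance Definition _ := [isSub for l2val].
HB.instance Definition _ := [Choice of l2 by <:].
HB.instance Definition _ := [SubChoice_isSubLmodule of l2 by <:].

Implicit Types f g h : l2.

Lemma l2P f : inl2 n (f : fock W).
Proof. by case: f => f /= /asboolP. Qed.

Definition mkl2 (f : fock W) (fl : inl2 n f) : l2 := L2 (introT (asboolP _) fl).

Lemma mkl2E (f : fock W) (fl : inl2 n f) : mkl2 fl = f :> (seq nat -> W).
Proof. by []. Qed.

Lemma l2_lin a f g w : (a *: f + g) w = a *: f w + g w.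
Proof. by []. Qed.

Lemma l2D f g w : (f + g) w = f w + g w. Proof. by []. Qed.

Lemma l2B f g w : (f - g) w = f w - g w. Proof. by []. Qed.

Lemma l2Z a f w : (a *: f) w = a *: f w. Proof. by []. Qed.

Lemma l2_ext f g : (forall w, f w = g w) -> f = g.
Proof. by move=> h; apply: val_inj; exact: funext. Qed.

Definition l2re f g : R :=
  2^-1 * (fnormsq n (f + g) - fnormsq n f - fnormsq n g).

Lemma l2re_cvg f g :
  ((fun N => \sum_(w <- words n N) re (@hinner R W) (f w) (g w)) @ \oo
    --> l2re f g)%classic.
Proof.
have -> : (fun N => \sum_(w <- words n N) re (@hinner R W) (f w) (g w)) =
   (fun N => 2^-1 * (psum n (f + g) N - psum n f N - psum n g N)).
  apply/funext => N; rewrite /psum -!sumrB mulr_sumr; apply: eq_bigr => w _.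
  exact: (re_polar (hform W)).
apply: cvgM; first exact: cvg_cst.
by apply: cvgB; [apply: cvgB|]; exact: psum_cvg (l2P _).
Qed.

Definition l2inner f g : R[i] := (l2re f g +i* l2re f ('i%C *: g))%C.

Lemma l2re_sq f : l2re f f = fnormsq n f.
Proof.
exact: (tends_uniq (@l2re_cvg f f) (psum_cvg (l2P f))).
Qed.

Lemma l2_form : form l2inner.
Proof.
have FW := hform W; apply: form_of_real.
- move=> f g h; apply: (tends_uniq (@l2re_cvg _ _)).
  under eq_fun do (under eq_bigr do rewrite l2D (reDl FW); rewrite big_split).
  by apply: cvgD; exact: l2re_cvg.
- move=> s f h; apply: (tends_uniq (@l2re_cvg _ _)).
  under eq_fun do (under eq_bigr do rewrite l2Z (reZl FW); rewrite -mulr_sumr).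
  by apply: cvgM; [exact: cvg_cst|exact: l2re_cvg].
- by move=> f g; rewrite /l2re [f + g]addrC addrAC.
- move=> f g; apply: (tends_uniq (@l2re_cvg _ _)).
  have -> : (fun N => \sum_(w <- words n N) re (@hinner R W) (('i%C *: f) w) (('i%C *: g) w))
     = (fun N => \sum_(w <- words n N) re (@hinner R W) (f w) (g w)).
    apply/funext => N; apply: eq_bigr => w _; rewrite !l2Z /re (formZl FW) (formZr FW).
    by case: (hinner _ _) => a b /=; ring.
  exact: l2re_cvg.
- by move=> f; rewrite l2re_sq fnormsq_ge0 //; exact: l2P.
Qed.

Definition l2nsq f : R := fnormsq n (f : fock W).

Lemma l2_sq f : sq l2inner f = l2nsq f.
Proof. exact: l2re_sq. Qed.

(** Each squared norm is expanded with [sqD]: the terms in [fnormsq f] and [fnormsq g] carry the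
    weights [1, 'i, -1, - 'i] and cancel, and the cross terms add up to four times the inner
    product. *)
Lemma finnerE f g : finner n (f : fock W) g = l2inner f g.
Proof.
have FF := l2_form; rewrite /finner !big_ord_recl big_ord0 /= /bump /= !addn0 add1n.
have i3 : 'i%C ^+ 3 = - 'i%C :> R[i] by rewrite exprS sqr_i mulrN1.
rewrite -complexiE expr0 expr1 sqr_i i3 addr0.
have key a : fnormsq n ((f : fock W) + a *: (g : fock W)) =
    fnormsq n f + 2 * re l2inner f (a *: g)
      + (complex.Re a ^+ 2 + complex.Im a ^+ 2) * fnormsq n g.
  by rewrite -[LHS](l2_sq (f + a *: g)) (sqD FF) (sqZ FF) !l2_sq.
rewrite !key /l2nsq scale1r scaleN1r scaleNr !(reNr FF) /l2inner.
rewrite -[re l2inner f ('i%C *: g)]/(l2re f ('i%C *: g)) -[re l2inner f g]/(l2re f g).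
set a := l2re f g; set b := l2re f _; set c := fnormsq n f; set d := fnormsq n g.
have -> : 1 * (c + 2 * a + (complex.Re 1 ^+ 2 + complex.Im 1 ^+ 2) * d)%:C%C +
  ('i%C * (c + 2 * b + (complex.Re 'i%C ^+ 2 + complex.Im 'i%C ^+ 2) * d)%:C%C +
  (-1 * (c + 2 * - a + (complex.Re (-1) ^+ 2 + complex.Im (-1) ^+ 2) * d)%:C%C +
  - 'i%C * (c + 2 * - b + (complex.Re (- 'i%C) ^+ 2 + complex.Im (- 'i%C) ^+ 2) * d)%:C%C))
  = 4 * (a +i* b)%C :> R[i].
  rewrite -[4 : R[i]](rmorph_nat (real_complex R)).
  by apply/eqP; rewrite eq_complex /=; apply/andP; split; apply/eqP; ring.
by rewrite mulrA mulVf ?mul1r // pnatr_eq0.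
Qed.

End L2.

(** * Creation operators and truncations *)

Section Shifts.
Variables (R : realType) (n : option nat) (W : hilbert R).
Implicit Types (f g : l2 n W) (w v : seq nat) (k : W).

Lemma sum_le_fnormsq (f : fock W) (s : seq (seq nat)) : inl2 n f -> uniq s ->
  {in s, forall w, validw n w} -> \sum_(w <- s) hnormsq (f w) <= fnormsq n f.
Proof.
move=> fl us vs; have [N NP] := sub_words vs.
apply: le_trans (psum_le N fl); apply: ler_sum_sub => //.
- exact: words_uniq.
- exact: NP.
- by move=> w; exact: hnormsq_ge0.
Qed.

(** Both inequalities reindex finite sums, by stripping the leading [i] from words and by adding it.
    Codes of words are not respected by this, hence the bound over arbitrary finite sets in
    [sum_le_fnormsq]. *)
Lemma Sft_inl2 i (f : fock W) : validg n i -> inl2 n f ->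
  inl2 n (Sft i f) /\ fnormsq n (Sft i f) = fnormsq n f.
Proof.
move=> vi fl; have h0 : hnormsq (0 : W) = 0 by exact: (sq0 (hform W)).
have [||l le] := @fnormsq_bound R n W (Sft i f) (fnormsq n f).
- case=> [//|j w] /=; case: eqP => [->|//]; rewrite vi /=; exact: fl.2.
- move=> N; pose s := [seq behead w | w <- words n N & (w != [::]) && (head 0%N w == i)].
  have -> : psum n (Sft i f) N = \sum_(w <- s) hnormsq (f w).
    rewrite big_map big_filter [RHS]big_mkcond; apply: eq_bigr => -[//|j w] _ /=.
    by case: eqP.
  apply: sum_le_fnormsq => // [|w].
    rewrite map_inj_in_uniq; first exact/filter_uniq/words_uniq.
    move=> [|a v] [|b w]; rewrite !mem_filter //=.
    by move=> /andP[/eqP -> _] /andP[/eqP -> _] ->.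
  move=> /mapP[[|a v]]; rewrite mem_filter //= => /andP[_ /words_valid] /= /andP[_ ?].
  by move=> ->.
split => //; apply/eqP; rewrite eq_le le /=.
have [] // := @fnormsq_bound R n W f (fnormsq n (Sft i f)) fl.2.
move=> N; have -> : psum n f N = \sum_(w <- map (cons i) (words n N)) hnormsq (Sft i f w).
  by rewrite big_map; apply: eq_bigr => w _ /=; rewrite eqxx.
apply: sum_le_fnormsq => //.
  by rewrite map_inj_uniq ?words_uniq // => a b [].
by move=> w /mapP[v /words_valid vv ->] /=; rewrite vi.
Qed.

Lemma one_inl2 k : inl2 n (one_tensor k).
Proof.
have [] // := @fnormsq_bound R n W (one_tensor k) (hnormsq k).
  by case.
move=> N; apply: le_trans (_ : \sum_(w <- [:: [::]]) hnormsq (@one_tensor R W k w) <= _).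
  rewrite /psum (bigID (pred1 [::])) /= [X in _ + X]big1 ?addr0; last first.
    by case=> // a w _; exact: (sq0 (hform W)).
  rewrite -big_filter; apply: ler_sum_sub => //; first exact/filter_uniq/words_uniq.
    by move=> w; rewrite mem_filter inE => /andP[].
  by move=> w; exact: hnormsq_ge0.
by rewrite big_seq1.
Qed.

Definition l2one k : l2 n W := mkl2 (one_inl2 k).

(** For an invalid [i] the shift of a nonzero function has support outside the valid words; the
    default 0 makes the operation total on [l2]. *)
Definition l2S (i : nat) f : l2 n W := insubd (0 : l2 n W) (Sft i (f : fock W)).

Lemma l2SE i f : validg n i -> val (l2S i f) = Sft i (f : fock W).
Proof.
move=> vi; rewrite val_insubd; case: ifP => // /asboolP[].
exact: (Sft_inl2 vi (l2P f)).1.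
Qed.

Lemma l2S_sq i f : validg n i -> l2nsq (l2S i f) = l2nsq f.
Proof. by move=> vi; rewrite /l2nsq -[l2val _]/(val _) l2SE // (Sft_inl2 vi (l2P f)).2. Qed.

Definition l2Sw w f : l2 n W := foldr l2S f w.

Lemma l2SwE w f : validw n w -> val (l2Sw w f) = Sword w (f : fock W).
Proof.
elim: w => [//|i w IH] /= /andP[vi vw].
by rewrite l2SE // -[l2val _]/(val _) IH.
Qed.

Lemma l2S_nil i f : validg n i -> l2S i f [::] = 0.
Proof. by move=> vi; rewrite -[l2val _]/(val _) l2SE. Qed.

Lemma l2S_cons i f j w : validg n i -> l2S i f (j :: w) = if j == i then f w else 0.
Proof. by move=> vi; rewrite -[l2val _]/(val _) l2SE. Qed.

Lemma l2S_lin i a f g : validg n i -> l2S i (a *: f + g) = a *: l2S i f + l2S i g.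
Proof.
move=> vi; apply: l2_ext => -[|j w]; rewrite l2_lin.
  by rewrite !l2S_nil // scaler0 addr0.
by rewrite !l2S_cons //; case: eqP => // _; rewrite scaler0 addr0.
Qed.

Lemma l2Sw_one v w k : validw n v -> l2Sw v (l2one k) w = if w == v then k else 0.
Proof.
elim: v w => [[]//|i v IH] w /= /andP[vi vv]; case: w => [|j w].
  by rewrite l2S_nil.
rewrite l2S_cons // eqseq_cons; case: eqP => //= _; exact: IH.
Qed.

Lemma l2Sw_short w f v : validw n w -> (size v < size w)%N -> l2Sw w f v = 0.
Proof.
elim: w v => [//|i w IH] [|j v] /= /andP[vi vw] vs; first by rewrite l2S_nil.
by rewrite l2S_cons //; case: eqP => // _; exact: IH.
Qed.

Lemma l2Sw_lin w a f g : validw n w -> l2Sw w (a *: f + g) = a *: l2Sw w f + l2Sw w g.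
Proof.
by elim: w => [//|i w IH] /= /andP[vi vw]; rewrite IH // l2S_lin.
Qed.

Lemma l2one_lin a k k' : l2one (a *: k + k') = a *: l2one k + l2one k'.
Proof. by apply: l2_ext => -[|j w]; rewrite l2_lin //= scaler0 addr0. Qed.

Definition trunc (s : seq (seq nat)) f : l2 n W := \sum_(w <- s) l2Sw w (l2one (f w)).

Lemma l2_sum (I : Type) (s : seq I) (F : I -> l2 n W) w :
  (\sum_(i <- s) F i) w = \sum_(i <- s) F i w.
Proof.
by elim: s => [|i s IH]; rewrite ?big_nil // !big_cons l2D IH.
Qed.

Lemma truncE s f w : uniq s -> {in s, forall w, validw n w} ->
  trunc s f w = if w \in s then f w else 0.
Proof.
move=> us vs; rewrite l2_sum; case: ifP => ws.
  rewrite (bigD1_seq w) //= l2Sw_one ?vs // eqxx big_seq_cond big1 ?addr0 //.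
  by move=> v /andP[/vs vv nvw]; rewrite l2Sw_one // eq_sym (negPf nvw).
rewrite big_seq big1 // => v vins; rewrite l2Sw_one ?vs //.
by case: eqP => // e; rewrite e vins in ws.
Qed.

Lemma trunc_dist f N :
  l2nsq (f - trunc (words n N) f) <= l2nsq f - psum n f N.
Proof.
have h0 : hnormsq (0 : W) = 0 by exact: (sq0 (hform W)).
have vN w : w \in words n N -> validw n w by exact: words_valid.
pose g := f - trunc (words n N) f.
have gE w : g w = f w - trunc (words n N) f w by [].
have [] // := @fnormsq_bound R n W g (l2nsq f - psum n f N).
  by move=> w nw; rewrite (l2P g).2.
clearbody g => M; rewrite lerBrDr.
apply: le_trans (psum_le (maxn M N) (l2P f)).
have [s [sE us sN]] := words_cat n (leq_maxr M N).
apply: le_trans (_ : psum n g (maxn M N) + psum n f N <= _).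
  by rewrite lerD2r; apply: psum_mono; exact: leq_maxl.
rewrite /psum sE !big_cat /= big_seq big1 ?add0r => [|w wN].
  rewrite [leLHS]addrC lerD2l big_seq [leRHS]big_seq; apply: ler_sum => w ws.
  by rewrite gE truncE ?words_uniq // (negPf (sN _ ws)) subr0.
by rewrite gE truncE ?words_uniq // wN subrr.
Qed.

Lemma trunc_cvg f (e : R) : 0 < e ->
  exists N, l2nsq (f - trunc (words n N) f) < e.
Proof.
move=> e0; have [N NP] := (@tendsP _ _ _).1 (psum_cvg (l2P f)) e e0.
exists N; apply: le_lt_trans (trunc_dist f N) _.
have := NP _ (leqnn N); rewrite distrC ger0_norm ?subr_ge0 //.
exact: psum_le (l2P f).
Qed.

Lemma l2inner_Sw_one f w k : validw n w ->
  l2inner f (l2Sw w (l2one k)) = hinner (f w) k.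
Proof.
have FW := hform W; move=> vw.
have key k' : l2re f (l2Sw w (l2one k')) = re (@hinner R W) (f w) k'.
  apply: (tends_uniq (@l2re_cvg _ _ _ _ _)).
  apply/tendsP => e e0; exists (pickle w).+1 => N wN.
  suff -> : \sum_(v <- words n N) re (@hinner R W) (f v) (l2Sw w (l2one k') v)
     = re (@hinner R W) (f w) k' by rewrite subrr normr0.
  rewrite (bigD1_seq w) ?words_uniq ?mem_words //= l2Sw_one // eqxx big1 ?addr0 //.
  by move=> v vw'; rewrite l2Sw_one // (negPf vw') (re0r FW).
have Z : 'i%C *: l2Sw w (l2one k) = l2Sw w (l2one ('i%C *: k)).
  apply: l2_ext => v; rewrite l2Z !l2Sw_one //.
  by case: eqP => // _; rewrite scaler0.
by rewrite /l2inner Z !key -(form_re FW).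
Qed.

End Shifts.

(** * Wold decomposition of a row isometry *)

Section LinearMaps.
Variables (R : realType) (V W : lmodType R[i]) (f : V -> W).
Hypothesis f_lin : forall a u v, f (a *: u + v) = a *: f u + f v.

Lemma lin0 : f 0 = 0.
Proof. by have := f_lin (-1) 0 0; rewrite scaler0 addr0 scaleN1r addNr. Qed.

Lemma linD u v : f (u + v) = f u + f v.
Proof. by rewrite -[u in LHS]scale1r f_lin scale1r. Qed.

Lemma linZ a u : f (a *: u) = a *: f u.
Proof. by rewrite -[a *: u]addr0 f_lin lin0 addr0. Qed.

Lemma linB u v : f (u - v) = f u - f v.
Proof. by rewrite linD -scaleN1r linZ scaleN1r. Qed.

Lemma lin_sum (I : Type) (s : seq I) (F : I -> V) :
  f (\sum_(i <- s) F i) = \sum_(i <- s) f (F i).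
Proof.
by elim: s => [|i s IH]; rewrite ?big_nil ?lin0 // !big_cons linD IH.
Qed.

End LinearMaps.

Section FormSum.
Variables (R : realType) (V : lmodType R[i]) (B : V -> V -> R[i]) (FB : form B).

Lemma re_suml (I : Type) (s : seq I) (F : I -> V) v :
  re B (\sum_(i <- s) F i) v = \sum_(i <- s) re B (F i) v.
Proof.
by elim: s => [|i s IH]; rewrite ?big_nil ?(re0l FB) // !big_cons (reDl FB) IH.
Qed.

Lemma formBl u v w : B (u - v) w = B u w - B v w.
Proof. by rewrite (formDl FB) -scaleN1r (formZl FB) mulN1r. Qed.

End FormSum.

Section Wold.
Variables (R : realType) (n : option nat) (K G : hilbert R).
Variables (L A : nat -> K -> K) (j : G -> K) (P : K -> G).
Hypothesis L_lin : forall i, validg n i -> forall a x y, L i (a *: x + y) = a *: L i x + L i y.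
Hypothesis A_lin : forall i, validg n i -> forall a x y, A i (a *: x + y) = a *: A i x + A i y.
Hypothesis A_adj : forall i, validg n i -> forall x y, hinner (A i x) y = hinner x (L i y).
Hypothesis A_L : forall i k, validg n i -> validg n k ->
  forall x, A i (L k x) = if i == k then x else 0.
Hypothesis j_iso : forall g h, hinner (j g) (j h) = hinner g h.
Hypothesis P_lin : forall a x y, P (a *: x + y) = a *: P x + P y.
Hypothesis P_adj : forall x g, hinner (P x) g = hinner x (j g).
Hypothesis A_j : forall i, validg n i -> forall g, A i (j g) = 0.
Hypothesis j_onto : forall x, (forall i, validg n i -> A i x = 0) -> exists g, j g = x.

Local Notation q := (sq (@hinner R K)).
Let FK := hform K.
Let FG := hform G.

Definition Lw w x := foldr L x w.
(** [foldl] against the [foldr] of [Lw]: the adjoint of a product reverses the order of its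
    factors. *)
Definition Aw w x := foldl (fun x i => A i x) x w.

Lemma Aw_adj w x y : validw n w -> hinner (Aw w x) y = hinner x (Lw w y).
Proof. by elim: w x => [//|i w IH] x /= /andP[vi vw]; rewrite IH // A_adj. Qed.

Lemma Aw_lin w a x y : validw n w -> Aw w (a *: x + y) = a *: Aw w x + Aw w y.
Proof. by elim: w x y => [//|i w IH] x y /= /andP[vi vw]; rewrite A_lin // IH. Qed.

Lemma Aw0 w : validw n w -> Aw w 0 = 0.
Proof. by move=> vw; apply: lin0 => *; exact: Aw_lin. Qed.

Lemma P_j g : P (j g) = g.
Proof. by apply: hinner_ext => h; rewrite P_adj j_iso. Qed.

Lemma P_L i x : validg n i -> P (L i x) = 0.
Proof.
move=> vi; apply: hinner_ext => g; rewrite P_adj (form0l FG).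
by apply: hinner_eq0C; rewrite -A_adj // A_j // (form0l FK).
Qed.

Definition coefs (x : K) : fock G := fun w => if validw n w then P (Aw w x) else 0.

Lemma coefs_lin a x y w : coefs (a *: x + y) w = a *: coefs x w + coefs y w.
Proof.
rewrite /coefs; case: ifP => vw; last by rewrite scaler0 addr0.
by rewrite Aw_lin // P_lin.
Qed.

Lemma coefs_adj x w g : validw n w -> hinner (coefs x w) g = hinner x (Lw w (j g)).
Proof. by move=> vw; rewrite /coefs vw P_adj Aw_adj. Qed.

Lemma coefs_L i x w : validg n i -> coefs (L i x) w = Sft i (coefs x) w.
Proof.
move=> vi; rewrite /coefs; case: w => [|k w] /=; first exact: P_L.
case: (eqVneq k i) => [->|ki].
  by rewrite vi /=; case: ifP => // vw; rewrite A_L // eqxx.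
case: ifP => // /andP[vk vw]; rewrite A_L // (negPf ki) Aw0 //.
exact: lin0.
Qed.

Lemma coefs_A i x w : validg n i -> coefs (A i x) w = coefs x (i :: w).
Proof. by move=> vi; rewrite /coefs /= vi. Qed.

Lemma coefs_Lw_j v w g : validw n v ->
  coefs (Lw v (j g)) w = if w == v then g else 0.
Proof.
elim: v w => [|i v IH] w /=.
  case: w => [|k w] _; rewrite /coefs /= ?P_j //.
  by case: ifP => // /andP[vk vw]; rewrite A_j // Aw0 // (lin0 P_lin).
case/andP=> vi vv; rewrite coefs_L //; case: w => [//|k w] /=.
by rewrite eqseq_cons; case: eqP => //= _; exact: IH.
Qed.

Definition partial x N : K := \sum_(w <- words n N) Lw w (j (coefs x w)).

Lemma coefs_partial x N w :
  coefs (partial x N) w = if w \in words n N then coefs x w else 0.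
Proof.
rewrite /partial (@lin_sum R _ _ (fun x => coefs x w)) => [|a u v]; last exact: coefs_lin.
case: ifP => wN.
  rewrite (bigD1_seq w) ?words_uniq //= coefs_Lw_j ?(words_valid wN) // eqxx.
  rewrite big_seq_cond big1 ?addr0 // => v /andP[/words_valid vv nvw].
  by rewrite coefs_Lw_j // eq_sym (negPf nvw).
rewrite big_seq big1 // => v vN; rewrite coefs_Lw_j ?(words_valid vN) //.
by case: eqP => // e; rewrite e vN in wN.
Qed.

Lemma re_partial x y N :
  re (@hinner R K) y (partial x N) =
  \sum_(w <- words n N) re (@hinner R G) (coefs y w) (coefs x w).
Proof.
rewrite (reC FK) (re_suml FK) big_seq [RHS]big_seq; apply: eq_bigr => w /words_valid vw.
by rewrite (reC FK) /re coefs_adj.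
Qed.

Lemma sq_partial x N : q (partial x N) = psum n (coefs x) N.
Proof.
rewrite /sq -[complex.Re _]/(re _ _ _) re_partial /psum big_seq [RHS]big_seq.
by apply: eq_bigr => w wN; rewrite coefs_partial wN.
Qed.

Lemma re_partial_self x N : re (@hinner R K) x (partial x N) = psum n (coefs x) N.
Proof. exact: re_partial. Qed.

(** Bessel's inequality for the orthogonal subspaces [L_w (j G)]. *)
Lemma psum_coefs_le x N : psum n (coefs x) N <= q x.
Proof.
have := sq_ge0 FK (x - partial x N).
by rewrite (sqB FK) re_partial_self sq_partial; lra.
Qed.

Lemma coefs_inl2 x : inl2 n (coefs x) /\ fnormsq n (coefs x) <= q x.
Proof.
apply: fnormsq_bound; last exact: psum_coefs_le.
by move=> w nw; rewrite /coefs (negPf nw).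
Qed.

(** [y] is the sum of the orthogonal series with terms [L_w (j (coefs x w))]. Its partial sums are
    Cauchy because their squared distances are differences of the convergent sequence
    [psum n (coefs x)]. *)
Lemma wold_shift_part x : exists y,
  (forall w, coefs (x - y) w = 0) /\ q y <= fnormsq n (coefs x).
Proof.
have [xl xle] := coefs_inl2 x.
have dist M N : (M <= N)%N ->
    q (partial x N - partial x M) = psum n (coefs x) N - psum n (coefs x) M.
  move=> MN; rewrite (sqB FK) !sq_partial re_partial.
  suff -> : \sum_(w <- words n M) re (@hinner R G) (coefs (partial x N) w) (coefs x w)
     = psum n (coefs x) M by lra.
  rewrite /psum big_seq [RHS]big_seq; apply: eq_bigr => w wM.
  by rewrite coefs_partial (words_sub MN wM).
have [|y yP] := @hcomplete _ K (partial x).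
  move=> e e0; have e2 : 0 < e / 2 by lra.
  have [N NP] := (@tendsP _ _ _).1 (psum_cvg xl) _ e2.
  exists N => m k Nm Nk; rewrite -/(sq _ _).
  wlog mk : m k Nm Nk / (k <= m)%N.
    by move=> h; case/orP: (leq_total k m) => ?; [|rewrite (sqBC FK)]; exact: h.
  rewrite dist //.
  have := NP _ Nm; have := NP _ Nk; rewrite !ltr_distl => /andP[? ?] /andP[? ?].
  lra.
have cy w : coefs (x - y) w = 0.
  case vw : (validw n w); last by rewrite /coefs vw.
  apply: hinner_ext => g; rewrite (form0l FG) coefs_adj //.
  apply: (@hinner_small0 R K) => e /yP[N NP].
  (* The index exceeds the code of [w], so that the coefficient of this remainder at [w] is exactly
     0. *)
  exists (x - partial x (maxn N (pickle w).+1)); split.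
    have -> : x - y - (x - partial x (maxn N (pickle w).+1)) =
        partial x (maxn N (pickle w).+1) - y.
      by rewrite opprB addrC addrA subrK.
    by apply: NP; exact: leq_maxl.
  rewrite -coefs_adj // addrC -scaleN1r coefs_lin coefs_partial.
  by rewrite mem_words ?leq_maxr // scaleN1r addNr (form0l FG).
exists y; split => //.
apply: (@le_of_small _ _ _ 1) => e /yP[N /(_ N (leqnn N))].
have cxy w : coefs y w = coefs x w.
  have := cy w; rewrite addrC -scaleN1r coefs_lin scaleN1r addrC => /eqP.
  by rewrite subr_eq0 => /eqP.
rewrite -/(sq _ _) (sqBC FK) (sqB FK) re_partial sq_partial.
have -> : \sum_(w <- words n N) re (@hinner R G) (coefs y w) (coefs x w)
    = psum n (coefs x) N.
  by apply: eq_bigr => w _; rewrite cxy.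
have := psum_le N xl; lra.
Qed.

Definition killed m (z : K) := forall w, validw n w -> size w = m -> Aw w z = 0.

Lemma killed0 m : killed m 0.
Proof. by move=> w vw _; exact: Aw0. Qed.

Lemma killed_lin m a x y : killed m x -> killed m y -> killed m (a *: x + y).
Proof.
by move=> hx hy w vw sw; rewrite Aw_lin // hx // hy // scaler0 addr0.
Qed.

(* [killed m] is the orthogonal complement of the ranges of the [Lw w] with
   [size w = m]. *)
Lemma killed_closed m p :
  (forall e : R, 0 < e -> exists v, killed m v /\ q (p - v) < e) -> killed m p.
Proof.
move=> h w vw sw; apply: hinner_ext => z; rewrite (form0l FK) Aw_adj //.
apply: (@hinner_small0 R K) => e /h[v [kv pv]]; exists v; split => //.
by rewrite -Aw_adj // kv // (form0l FK).
Qed.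

Lemma killed_A m i x : validg n i -> killed m.+1 x -> killed m (A i x).
Proof. by move=> vi kx w vw sw; apply: (kx (i :: w)); rewrite /= ?vi ?sw. Qed.

Lemma killed_L m i x : validg n i -> killed m x -> killed m.+1 (L i x).
Proof.
move=> vi kx [//|k w] /= /andP[vk vw] [sw]; rewrite A_L //.
by case: eqP => _; [exact: kx | exact: Aw0].
Qed.

(* Project [z] onto [killed m.+1]: the projection [u] is wandering, because the
   [A i u] are both in [killed m] and orthogonal to it, and it is orthogonal to
   the wandering vectors, so it vanishes. *)
Lemma coefs0_orth_killed m z z' : (forall w, coefs z w = 0) -> killed m z' ->
  hinner z z' = 0.
Proof.
elim: m z z' => [|m IH] z z' cz kz'.
  by have /= -> := kz' [::] isT erefl; rewrite (form0r FK).
have [u [/killed_closed ku zu]] :=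
  projection (@killed0 m.+1) (@killed_lin m.+1) z.
suff u0 : u = 0 by rewrite u0 subr0 in zu; exact: zu.
have Au i : validg n i -> A i u = 0.
  move=> vi; apply: hinner_eq0.
  have kAu := killed_A vi ku.
  rewrite A_adj //.
  have := zu _ (killed_L vi kAu); rewrite (formBl FK) => /eqP.
  rewrite subr_eq0 => /eqP <-; rewrite -A_adj //.
  by apply: IH => // w; rewrite coefs_A.
have [g gu] := j_onto Au.
apply: hinner_eq0; have := zu _ ku; rewrite (formBl FK) => /eqP.
rewrite subr_eq0 => /eqP <-; rewrite -gu -P_adj.
by have := cz [::]; rewrite /coefs /= => ->; rewrite (form0l FG).
Qed.

End Wold.

(** Positivity makes [B w w] real; applied to [u + v] and to ['i *: u + v] this yields the imaginary
    and the real part of the Hermitian symmetry. *)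
Lemma form_of_positive (R : realType) (V : lmodType R[i]) (B : V -> V -> R[i]) :
  (forall a u v w, B (a *: u + v) w = a * B u w + B v w) ->
  (forall a u v w, B w (a *: u + v) = conjc a * B w u + B w v) ->
  (forall u, 0 <= B u u) -> form B.
Proof.
move=> hl hr hp; split => // u v.
have im w : complex.Im (B w w) = 0 by apply: ger0_Im.
have h1 := im (1 *: u + v); have h2 := im ('i%C *: u + v).
rewrite hl !hr in h1; rewrite hl !hr in h2.
have := im u; have := im v; rewrite conj_conjc.
move: h1 h2; case: (B u u) (B u v) (B v u) (B v v) => [a1 a2] [b1 b2] [c1 c2] [d1 d2] /=.
by move=> h1 h2 e1 e2; congr (_ +i* _)%C; lra.
Qed.

(** * The row isometry induced by a Toeplitz form *)

Section WoldModel.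
Variables (R : realType) (n : option nat).

Record wold_data (K G : hilbert R) (L A : nat -> K -> K) (j : G -> K) (P : K -> G) :
  Prop := WoldData {
  wd_L_lin : forall i, validg n i -> forall a x y, L i (a *: x + y) = a *: L i x + L i y;
  wd_A_lin : forall i, validg n i -> forall a x y, A i (a *: x + y) = a *: A i x + A i y;
  wd_A_adj : forall i, validg n i -> forall x y, hinner (A i x) y = hinner x (L i y);
  wd_A_L : forall i k, validg n i -> validg n k ->
    forall x, A i (L k x) = if i == k then x else 0;
  wd_j_iso : forall g h, hinner (j g) (j h) = hinner g h;
  wd_P_lin : forall a x y, P (a *: x + y) = a *: P x + P y;
  wd_P_adj : forall x g, hinner (P x) g = hinner x (j g);
  wd_A_j : forall i, validg n i -> forall g, A i (j g) = 0;
  wd_j_onto : forall x, (forall i, validg n i -> A i x = 0) -> exists g, j g = x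
}.

Lemma adjoint_exists (H H' : hilbert R) (A : H -> H') :
  (forall a x y, A (a *: x + y) = a *: A x + A y) ->
  (forall x, sq (@hinner R H') (A x) <= sq (@hinner R H) x) ->
  exists L : H' -> H, (forall x y, hinner (A x) y = hinner x (L y)) /\
    forall a x y, L (a *: x + y) = a *: L x + L y.
Proof.
move=> A_lin A_le; have FH := hform H; have FH' := hform H'.
have ex y : exists z : H, forall x, hinner z x = hinner y (A x).
  have phiP a u v : hinner y (A (a *: u + v)) =
      conjc a * hinner y (A u) + hinner y (A v).
    by rewrite A_lin (formDr FH') (formZr FH').
  have phi_le v : complex.Re (hinner y (A v)) ^+ 2 <=
      sq (@hinner R H') y * sq (@hinner R H) v.
    apply: le_trans (re_CS FH' y (A v)) _.
    by rewrite ler_wpM2l ?(sq_ge0 FH').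
  have [z [_ zP]] := @riesz_dense R H H id (fun v => hinner y (A v)) _
    (fun=> fun=> fun=> erefl) phiP (sq_ge0 FH' y) phi_le.
  by exists z.
have [L LP] := choice ex; exists L; split.
  by move=> x y; rewrite hinner_sym [RHS]hinner_sym LP.
move=> a x y; apply: hinner_ext => z.
by rewrite LP (formDl FH) (formZl FH) (formDl FH') (formZl FH') !LP.
Qed.

(** The backward shifts come before the isometries: [A i] is the adjoint of the isometry
    [iota v |-> iota (S i v)], supplied by [dense_transfer], and [L i] is the adjoint of [A i]. The
    wandering space [G] is the complement of all ranges of the [L i], that is, the common kernel of
    the [A i]. *)
Lemma wold_model (V : lmodType R[i]) (B : V -> V -> R[i]) (S : nat -> V -> V) :
  form B ->
  (forall i, validg n i -> forall a u v, S i (a *: u + v) = a *: S i u + S i v) ->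
  (forall i k, validg n i -> validg n k -> forall u v,
    B (S k u) (S i v) = (i == k)%:R * B u v) ->
  exists (K G : hilbert R) (iota : V -> K) (L A : nat -> K -> K) (j : G -> K) (P : K -> G),
  [/\ wold_data L A j P,
      forall a u v, iota (a *: u + v) = a *: iota u + iota v,
      forall u v, hinner (iota u) (iota v) = B u v,
      forall x : K, (forall v, hinner x (iota v) = 0) -> x = 0
    & forall i, validg n i -> forall v, L i (iota v) = iota (S i v)].
Proof.
move=> FB S_lin S_B.
have [K [iota [iota_lin iota_B iota_dense]]] := completion_theorem FB.
have FK := hform K.
have ext (x y : K) : (forall v, hinner x (iota v) = hinner y (iota v)) -> x = y.
  move=> h; apply/eqP; rewrite -subr_eq0; apply/eqP; apply: iota_dense => v.
  by rewrite (formBl FK) h subrr.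
have exA i : exists A : K -> K, validg n i ->
    (forall x v, hinner (A x) (iota v) = hinner x (iota (S i v))) /\
    forall x, sq (@hinner R K) (A x) <= sq (@hinner R K) x.
  case vi : (validg n i); last by exists id.
  have l1 a u v : iota (S i (a *: u + v)) = a *: iota (S i u) + iota (S i v).
    by rewrite S_lin.
  have l2 v : sq (@hinner R K) (iota (S i v)) = sq (@hinner R K) (iota v).
    by rewrite /sq !iota_B S_B // eqxx mul1r.
  by have [A AP] := dense_transfer l1 iota_lin l2; exists A.
have [A AP] := choice exA.
have A_lin i : validg n i -> forall a x y, A i (a *: x + y) = a *: A i x + A i y.
  move=> /AP[Ai _] a x y; apply: ext => v.
  by rewrite Ai !(formDl FK) !(formZl FK) !Ai.
have exL i : exists L : K -> K, validg n i ->
    (forall x y, hinner (A i x) y = hinner x (L y)) /\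
    forall a x y, L (a *: x + y) = a *: L x + L y.
  case vi : (validg n i); last by exists id.
  by have [L LP] := adjoint_exists (A_lin i vi) (AP i vi).2; exists L.
have [L LP] := choice exL.
have A_adj i : validg n i -> forall x y, hinner (A i x) y = hinner x (L i y).
  by move=> /LP[].
have L_iota i : validg n i -> forall v, L i (iota v) = iota (S i v).
  move=> vi v; apply: hinner_ext => z.
  by rewrite hinner_sym -A_adj // (AP i vi).1 -hinner_sym.
have A_iota i k : validg n i -> validg n k -> forall v,
    A i (iota (S k v)) = if i == k then iota v else 0.
  move=> vi vk v; apply: ext => u; rewrite (AP i vi).1 iota_B S_B //.
  by case: eqP => _; rewrite ?iota_B ?mul1r // mul0r (form0l FK).
have [G [j [j_lin j_iso jD jO]]] :=
  @orth_hilbert R K (fun d => exists i y, validg n i /\ d = L i y).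
have FG := hform G.
have [|P [P_adj P_lin]] := @adjoint_exists G K j j_lin.
  by move=> g; rewrite /sq j_iso.
exists K, G, iota, L, A, j, P; split => //; split => //.
- by move=> i /LP[].
- move=> i k vi vk x; apply: ext => v.
  rewrite A_adj // L_iota // hinner_sym.
  rewrite [hinner (iota _) _]hinner_sym.
  have -> : hinner (L k x) (iota (S i v)) = hinner x (A k (iota (S i v))).
    by rewrite hinner_sym -A_adj // -hinner_sym.
  rewrite A_iota // eq_sym -hinner_sym -hinner_sym.
  by case: eqP => _ //; rewrite (form0l FK) (form0r FK).
- by move=> x g; rewrite hinner_sym -P_adj -hinner_sym.
- move=> i vi g; apply: hinner_ext => z; rewrite A_adj // (form0l FK).
  by apply: jD; exists i, z.
- move=> x Ax; apply: jO => _ [i [y [vi ->]]].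
  by rewrite -A_adj // Ax // (form0l FK).
Qed.

End WoldModel.

(** * Lifting operators to [l2] *)

Section Lifts.
Variables (R : realType) (n : option nat).

Lemma bounded_op_lift (V W : hilbert R) (M : fock V -> fock W) : bounded_op n M ->
  exists F : l2 n V -> l2 n W,
  [/\ forall f, val (F f) = M (val f),
      forall a (f g : l2 n V), F (a *: f + g) = a *: F f + F g
    & exists c : R, 0 <= c /\ forall f, l2nsq (F f) <= c * l2nsq f].
Proof.
case=> Ml M_lin [c cP].
pose F (f : l2 n V) := mkl2 (Ml f (l2P f)).
exists F; split => //.
  by move=> a f g; apply: val_inj; rewrite /= (M_lin a f g (l2P f) (l2P g)).
(* The constant in [bounded_op] carries no sign condition, whereas later estimates need it
   nonnegative. *)
exists (Num.max c 0); split; first by rewrite le_max lexx orbT.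
move=> f; apply: le_trans (cP f (l2P f)) _.
by rewrite ler_wpM2r ?fnormsq_ge0 ?le_max ?lexx //; exact: l2P.
Qed.

Lemma multi_analytic_lift (V W : hilbert R) (M : fock V -> fock W) :
  multi_analytic n M ->
  exists F : l2 n V -> l2 n W,
  [/\ forall f, val (F f) = M (val f),
      forall a (f g : l2 n V), F (a *: f + g) = a *: F f + F g,
      forall i f, validg n i -> F (l2S i f) = l2S i (F f)
    & exists c : R, 0 <= c /\ forall f, l2nsq (F f) <= c * l2nsq f].
Proof.
case=> /bounded_op_lift[F [FE F_lin Fc]] MS; exists F; split => // i f vi.
apply: val_inj; rewrite FE !l2SE // MS //; last exact: l2P.
by rewrite -[LHS]/(Sft i (M (val f))) -FE.
Qed.

Section MultiAnalytic.
Variables (V W : hilbert R) (F : l2 n V -> l2 n W) (c : R).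
Hypothesis F_lin : forall a (f g : l2 n V), F (a *: f + g) = a *: F f + F g.
Hypothesis F_S : forall i f, validg n i -> F (l2S i f) = l2S i (F f).
Hypothesis c_ge0 : 0 <= c.
Hypothesis F_le : forall f, l2nsq (F f) <= c * l2nsq f.

Lemma multi_analytic_Sw w f : validw n w -> F (l2Sw w f) = l2Sw w (F f).
Proof. by elim: w => [//|i w IH] /= /andP[vi vw]; rewrite F_S // IH. Qed.

(** On a finite truncation every surviving monomial begins with a word of length at least [m], which
    [F] carries through as a shift. Boundedness passes this to [f], since evaluation at [w] is
    continuous. *)
Lemma multi_analytic_low m (f : l2 n V) : (forall w, (size w < m)%N -> f w = 0) ->
  forall w, (size w < m)%N -> F f w = 0.
Proof.
move=> f0 w wm; apply: (@sq_le0 R W).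
apply: (@le0_of_small _ _ c) => e e0.
have [N NP] := trunc_cvg f e0.
have t0 : F (trunc (words n N) f) w = 0.
  rewrite (lin_sum F_lin) l2_sum big_seq big1 // => v /words_valid vv.
  rewrite multi_analytic_Sw //.
  have [vm|mv] := ltnP (size v) m.
    rewrite f0 // (lin0 (@l2one_lin R n V)) (lin0 F_lin).
    by rewrite (lin0 (fun a f g => @l2Sw_lin R n W v a f g vv)).
  by apply: l2Sw_short => //; exact: leq_trans wm mv.
have -> : F f w = F (f - trunc (words n N) f) w by rewrite (linB F_lin) l2B t0 subr0.
apply: le_trans (hnormsq_le_fnormsq w (l2P _)) _.
apply: le_trans (F_le _) _; rewrite mulrC.
by rewrite ler_wpM2r // ltW.
Qed.

End MultiAnalytic.

Lemma in_span_sum (W : hilbert R) (D : fock W -> Prop) (I : eqType) (s : seq I)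
  (F : I -> fock W) : {in s, forall i, D (F i)} -> in_span D (\sum_(i <- s) F i).
Proof.
elim: s => [|i s IH] DF; first by rewrite big_nil; exact: span0.
rewrite big_cons addrC -[F i]scale1r; apply: spanS.
  by apply: IH => k ks; apply: DF; rewrite inE ks orbT.
by apply: DF; rewrite inE eqxx.
Qed.

End Lifts.

Lemma toeplitz_form (R : realType) (n : option nat) (E : hilbert R)
  (T : fock E -> fock E) : multi_toeplitz n T -> positive_op n T ->
  exists B : l2 n E -> l2 n E -> R[i],
  [/\ form B,
      forall f g, finner n (T (val f)) (val g) = B f g,
      forall i k, validg n i -> validg n k -> forall u v,
        B (l2S k u) (l2S i v) = (i == k)%:R * B u v
    & exists c : R, 0 <= c /\ forall f, sq B f <= c * l2nsq f].
Proof.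
case=> /bounded_op_lift[F [FE F_lin [c [c0 cP]]]] TS Tpos.
have FL := l2_form n E.
pose B f g := l2inner (F f) g.
have BE f g : finner n (T (val f)) (val g) = B f g by rewrite -FE finnerE.
exists B; split => //.
- apply: form_of_positive.
  + by move=> a u v w; rewrite /B F_lin (formDl FL) (formZl FL).
  + by move=> a u v w; rewrite /B (formDr FL) (formZr FL).
  + by move=> u; rewrite -BE; apply: Tpos; exact: l2P.
- move=> i k vi vk u v; rewrite -!BE !l2SE //.
  by apply: TS => //; exact: l2P.
(* [c] bounds the squared norm of [T]; the form is bounded through
   [2 * Re <T f, f> <= |T f|^2 + |f|^2]. *)
- exists (c + 1); split; first by lra.
  move=> f; have := re_le FL (F f) f; rewrite !l2_sq.
  have := cP f; have := fnormsq_ge0 (l2P f); have := fnormsq_ge0 (l2P (F f)).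
  rewrite -!/(l2nsq _) -/(sq B f) -[re _ _ _]/(sq B f).
  have -> : (c + 1) * l2nsq f = c * l2nsq f + l2nsq f by ring.
  lra.
Qed.

(** * Existence *)

Section Existence.
Variables (R : realType) (n : option nat) (E : hilbert R) (T : fock E -> fock E).
Variables (B : l2 n E -> l2 n E -> R[i]) (c : R).
Hypothesis FB : form B.
Hypothesis TB : forall f g, finner n (T (val f)) (val g) = B f g.
Hypothesis B_le : 0 <= c /\ forall f, sq B f <= c * l2nsq f.

Variables (K G : hilbert R) (iota : l2 n E -> K) (L A : nat -> K -> K).
Variables (j : G -> K) (P : K -> G).
Hypothesis WD : wold_data n L A j P.
Hypothesis iota_lin : forall a u v, iota (a *: u + v) = a *: iota u + iota v.
Hypothesis iota_B : forall u v, hinner (iota u) (iota v) = B u v.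
Hypothesis iota_dense : forall x : K, (forall v, hinner x (iota v) = 0) -> x = 0.
Hypothesis L_iota : forall i, validg n i -> forall v, L i (iota v) = iota (l2S i v).

Local Notation q := (sq (@hinner R K)).
Let FK := hform K.

(** Outside [l2] there is nothing to embed into [K]; the value 0 is arbitrary, as only the action on
    [l2] matters. *)
Definition factor (f : fock E) : fock G :=
  if pselect (inl2 n f) is left fl then coefs n A P (iota (mkl2 fl)) else 0.

Lemma factorE (f : l2 n E) : factor (val f) = coefs n A P (iota f).
Proof.
rewrite /factor; case: pselect => [fl|[]]; last exact: l2P.
by congr (coefs _ _ _ (iota _)); apply: val_inj.
Qed.

Lemma iota_sq v : q (iota v) = sq B v.
Proof. by rewrite /sq iota_B. Qed.

Let coefs_ok x : inl2 n (coefs n A P x) /\ fnormsq n (coefs n A P x) <= q x.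
Proof. by case: WD => *; exact: (@coefs_inl2 R n K G L A j P). Qed.

Let C x : l2 n G := mkl2 (coefs_ok x).1.

Let C_le x : l2nsq (C x) <= q x.
Proof. exact: (coefs_ok x).2. Qed.

Let C_lin a x y : C (a *: x + y) = a *: C x + C y.
Proof.
case: WD => *; apply: l2_ext => w.
rewrite -[LHS]/(coefs n A P _ w) l2_lin.
exact: (@coefs_lin R n K G A P).
Qed.

Let factorC (f : l2 n E) : factor (val f) = val (C (iota f)).
Proof. exact: factorE. Qed.

Lemma factor_multi_analytic : multi_analytic n factor.
Proof.
split; [split|].
- by move=> f fl; rewrite -(mkl2E fl) -[l2val _]/(val _) factorC; exact: l2P.
- move=> a f g fl gl.
  rewrite -(mkl2E fl) -(mkl2E gl) -[l2val (mkl2 fl)]/(val _) -[l2val (mkl2 gl)]/(val _).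
  by rewrite -[a *: _ + _]/(val (a *: mkl2 fl + mkl2 gl)) !factorC iota_lin C_lin.
- exists c => f fl; rewrite -(mkl2E fl) -[l2val _]/(val _) factorC.
  apply: le_trans (C_le _) _; rewrite iota_sq; exact: B_le.2.
- move=> i vi f fl.
  rewrite -(mkl2E fl) -[l2val _]/(val _) -(l2SE (mkl2 fl) vi) !factorE -L_iota //.
  by apply/funext => w; case: WD => *; apply: (@coefs_L R n K G L A j P).
Qed.

Lemma factor_le : MM_le n factor T.
Proof.
move=> f fl; rewrite -(mkl2E fl) -[l2val _]/(val _) TB (form_sq FB) lecR.
by rewrite factorC -iota_sq; exact: C_le.
Qed.

Lemma iota_approx (x : K) (e : R) : 0 < e -> exists N (v : l2 n E),
  q (x - iota (trunc (words n N) v)) < e.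
Proof.
move=> e0; have [|v xv] := dense_of_orth0 iota_lin iota_dense x (e := e / 4).
  by lra.
(* [iota] expands squared norms by at most [c]; dividing by [c + 1] also covers [c = 0]. *)
have [|N NP] := @trunc_cvg R n E v (e / 4 / (c + 1)).
  by have [] := B_le => c0 _; rewrite !divr_gt0 //; lra.
exists N, v; have [c0 cP] := B_le.
have -> : x - iota (trunc (words n N) v) =
    (x - iota v) + iota (v - trunc (words n N) v).
  by rewrite (linB iota_lin) addrA subrK.
apply: le_lt_trans (sqD_le FK _ _) _; rewrite iota_sq.
have := cP (v - trunc (words n N) v); move: NP.
have := fnormsq_ge0 (l2P (v - trunc (words n N) v)); rewrite -/(l2nsq _).
move: (sq B _) (l2nsq _) => b a a0; rewrite ltr_pdivlMr; last by lra.
by rewrite mulrDr mulr1 [a * c]mulrC; lra.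
Qed.

(** A truncation of [f] is the coefficient function of a finite Wold sum [z] in [K]. Approximating
    [z] by images of truncations, and not merely of [l2] functions, puts the approximant in the
    algebraic span of the shifted symbols; the coefficient map is a contraction and keeps the
    error. *)
Lemma factor_outer : outer n factor.
Proof.
move=> f fl e e0; pose f' := mkl2 fl.
have [|N NP] := @trunc_cvg R n G f' (e / 4); first by lra.
pose z := \sum_(w <- words n N) Lw L w (j (f' w)).
have Cz : C z = trunc (words n N) f'.
  rewrite (lin_sum C_lin) /trunc big_seq [RHS]big_seq.
  apply: eq_bigr => w /words_valid vw; apply: l2_ext => v.
  rewrite l2Sw_one // -[LHS]/(coefs n A P _ v); case: WD => *.
  exact: (@coefs_Lw_j R n K G L A j P).
have [|M [v zv]] := @iota_approx z (e / 4); first by lra.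
exists (factor (val (trunc (words n M) v))); split; last first.
  rewrite factorC.
  have -> : fnormsq n (f - val (C (iota (trunc (words n M) v)))) =
      l2nsq (f' - C (iota (trunc (words n M) v))) by [].
  have -> : f' - C (iota (trunc (words n M) v)) =
      (f' - trunc (words n N) f') + C (z - iota (trunc (words n M) v)).
    by rewrite (linB C_lin) Cz addrA subrK.
  have := sqD_le (l2_form n G) (f' - trunc (words n N) f')
    (C (z - iota (trunc (words n M) v))).
  rewrite !l2_sq => h; apply: le_lt_trans h _.
  have := C_le (z - iota (trunc (words n M) v)); lra.
have [_ MS] := factor_multi_analytic.
have FS w k : validw n w -> factor (val (l2Sw w (l2one n k))) = Sword w (symbol factor k).
  elim: w => [//|i w IH] /= /andP[vi vw].
  rewrite -[l2val _]/(val _) l2SE // MS //; last exact: l2P.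
  by rewrite -[l2val _]/(val _) IH.
rewrite factorC /trunc (lin_sum iota_lin) (lin_sum C_lin).
have -> : val (\sum_(w <- words n M) C (iota (l2Sw w (l2one n (v w))))) =
   \sum_(w <- words n M) val (C (iota (l2Sw w (l2one n (v w))))).
  by apply: (big_morph (val : l2 n G -> fock G)).
apply: in_span_sum => w /words_valid vw; exists w, (v w).
by split => //; rewrite -factorC FS.
Qed.

Lemma factor_maximal (N : hilbert R) (Th : fock E -> fock N) :
  multi_analytic n Th -> MM_le n Th T -> MM_le_MM n Th factor.
Proof.
move=> /multi_analytic_lift[F [FE F_lin F_S [d [d0 F_le]]]] ThT f0 f0l.
pose f := mkl2 f0l; rewrite -(mkl2E f0l) -/f -[l2val f]/(val f) -FE factorC.
have F_B g : l2nsq (F g) <= sq B g.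
  have := ThT _ (l2P g); rewrite -[l2val g]/(val g) TB (form_sq FB) lecR.
  by rewrite -FE.
have [y [cy yle]] : exists y, (forall w, coefs n A P (iota f - y) w = 0) /\
    q y <= l2nsq (C (iota f)).
  by case: WD => *; exact: (@wold_shift_part R n K G L A j P).
rewrite -!/(l2nsq _); apply: le_trans yle.
apply: (@le_of_small _ _ _ (q y + 3)) => e e0.
have [M MP] : exists M, l2nsq (F f) - e < psum n (F f) M.
  have [M MP] := (@tendsP _ _ _).1 (psum_cvg (l2P (F f))) e e0; exists M.
  by have := MP _ (leqnn M); rewrite ltr_distl => /andP[].
(* The successor makes every word of [words n M] strictly shorter than [m], so that it lies where
   images of [low] functions vanish. *)
pose m := (\max_(w <- words n M) size w).+1.
pose low v := forall w, (size w < m)%N -> (v : l2 n E) w = 0.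
have low_lin a u v : low u -> low v -> low (a *: u + v).
  by move=> lu lv w wm; rewrite l2_lin lu // lv // scaler0 addr0.
pose D k := exists v, low v /\ k = iota v.
have D0 : D 0 by exists 0; split => //; rewrite (lin0 iota_lin).
have D_lin a x x' : D x -> D x' -> D (a *: x + x').
  by case=> v [lv ->] [v' [lv' ->]]; exists (a *: v + v'); rewrite iota_lin;
     split => //; exact: low_lin.
pose z := iota f - y.
have [p [pD zp]] := projection D0 D_lin z.
(* Shifting by a word of length [m] produces a [low] function, to whose image [z - p] is
   orthogonal. *)
have kz : killed n A m (z - p).
  move=> w vw wm; apply: iota_dense => v.
  have -> : hinner (Aw A w (z - p)) (iota v) = hinner (z - p) (iota (l2Sw w v)).
    have -> : iota (l2Sw w v) = Lw L w (iota v).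
      by elim: (w) vw => [//|i w' IH] /= /andP[vi vw']; rewrite -L_iota // IH.
    by case: WD => *; exact: (@Aw_adj R n K L A).
  apply: zp; exists (l2Sw w v); split => // w' w'm.
  by apply: l2Sw_short; rewrite // wm.
(* Both terms of [hinner z (z - p) - hinner p (z - p)] vanish: the first because [z] has no
   coefficients while [z - p] is killed, the second because [p] is a limit of vectors orthogonal to
   [z - p]. *)
have zz : z - p = 0.
  apply: hinner_eq0; rewrite (formBl FK).
  have -> : hinner z (z - p) = 0.
    by case: WD => ? A_lin A_adj A_L ? ? P_adj _ j_onto;
       exact: (coefs0_orth_killed A_lin A_adj A_L P_adj j_onto cy kz).
  rewrite sub0r; apply/eqP; rewrite oppr_eq0; apply/eqP.
  apply: (@hinner_small0 R K) => e' /pD[v [Dv pv]]; exists v; split => //.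
  by apply: hinner_eq0C; exact: zp.
have zpE : z = p by apply/eqP; rewrite -subr_eq0 zz.
(* The bound [e ^+ 2] controls the cross term with [y], and [e] the square of the error itself. *)
have [|_ [[v [lv ->]] vz]] := pD (Num.min (e ^+ 2) e).
  by rewrite lt_min e0 exprn_gt0.
rewrite -zpE lt_min in vz; case/andP: vz => ve2 ve.
(* Subtracting the [low] function [v] leaves the coefficients of [F f] on [words n M] unchanged,
   while the norm of [F (f - v)] is bounded by the form. *)
have le1 : psum n (F f) M <= sq B (f - v).
  apply: le_trans (F_B _); apply: le_trans (psum_le M (l2P _)).
  rewrite /psum le_eqVlt; apply/orP; left; apply/eqP.
  rewrite big_seq [RHS]big_seq; apply: eq_bigr => w wM.
  rewrite (linB F_lin) l2B (multi_analytic_low F_lin F_S d0 F_le lv) ?subr0 //.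
  by rewrite /m ltnS; exact: (leq_bigmax_seq _ wM).
have le2 : sq B (f - v) = q (y + (z - iota v)).
  by rewrite -iota_sq (linB iota_lin) /z addrA [y + _]addrC subrK.
rewrite le2 (sqD FK) in le1.
(* Arithmetic-geometric inequality with weight [e]; dividing by [e] turns the bound [e ^+ 2] into
   [e]. *)
have le3 : 2 * re (@hinner R K) y (z - iota v) <= e * q y + e.
  have := sq_ge0 FK (e%:C%C *: y - (z - iota v)).
  rewrite (sqB FK) (reZl FK) (sqZr FK) => h.
  rewrite -(ler_pM2l e0); move: ve2 h; rewrite mulrDr !expr2; lra.
have -> : e * (q y + 3) = e * q y + 3 * e by ring.
lra.
Qed.

End Existence.

Theorem max_outer_factor_exists (R : realType) (n : option nat) (E : hilbert R)
    (T : fock E -> fock E) : multi_toeplitz n T -> positive_op n T ->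
  exists (G : hilbert R) (phi : fock E -> fock G), max_outer_factor n T phi.
Proof.
move=> Tt Tp; have [B [FB TB B_S [c cP]]] := toeplitz_form Tt Tp.
have S_lin i : validg n i -> forall a (u v : l2 n E),
    l2S i (a *: u + v) = a *: l2S i u + l2S i v.
  by move=> vi a u v; exact: l2S_lin.
have [K [G [iota [L [A [j [P [WD iota_lin iota_B iota_dense L_iota]]]]]]]] :=
  wold_model FB S_lin B_S.
exists G, (factor iota A P); split.
- exact: (factor_multi_analytic cP WD iota_lin iota_B L_iota).
- exact: (factor_outer cP WD iota_lin iota_B iota_dense L_iota).
- exact: (factor_le FB TB WD iota_B).
- exact: (factor_maximal FB TB WD iota_lin iota_B iota_dense L_iota).
Qed.

(** * Uniqueness *)

Section Vacuum.
Variables (R : realType) (n : option nat) (W : hilbert R).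
Implicit Types h : l2 n W.

Lemma l2inner_one h k : l2inner h (l2one n k) = hinner (h [::]) k.
Proof. exact: (@l2inner_Sw_one R n W h [::] k). Qed.

Lemma l2nsq_vacuum h : l2nsq h = hnormsq (h [::]) + l2nsq (h - l2one n (h [::])).
Proof.
have FL := l2_form n W; rewrite -!l2_sq (sqB FL).
have -> : re (@l2inner R n W) h (l2one n (h [::])) = hnormsq (h [::]).
  by rewrite /re l2inner_one.
have -> : sq (@l2inner R n W) (l2one n (h [::])) = hnormsq (h [::]).
  by rewrite /sq l2inner_one.
ring.
Qed.

Lemma l2Sw_sq w h : validw n w -> l2nsq (l2Sw w h) = l2nsq h.
Proof. by elim: w => [//|i w IH] /= /andP[vi vw]; rewrite l2S_sq // IH. Qed.

End Vacuum.

(** * Density of the range of an outer operator *)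

Section OuterDense.
Variables (R : realType) (n : option nat) (V W : hilbert R) (M : fock V -> fock W).
Variables (F : l2 n V -> l2 n W) (c : R).
Hypothesis FE : forall f, val (F f) = M (val f).
Hypothesis F_lin : forall a (f g : l2 n V), F (a *: f + g) = a *: F f + F g.
Hypothesis F_S : forall i f, validg n i -> F (l2S i f) = l2S i (F f).
Hypothesis M_outer : outer n M.

Lemma in_span_range g :
  in_span (fun v => exists alpha (k : V),
     validw n alpha /\ v = Sword alpha (symbol M k)) g ->
  exists v, g = val (F v).
Proof.
elim=> [|g' a v' _ [v ->] [w [k [vw ->]]]]; first by exists 0; rewrite (lin0 F_lin).
exists (a *: l2Sw w (l2one n k) + v).
have -> : symbol M k = val (F (l2one n k)) by rewrite FE.
by rewrite F_lin (multi_analytic_Sw F_S) // addrC -(l2SwE _ vw).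
Qed.

Lemma outer_dense (h : l2 n W) (e : R) : 0 < e -> exists v, l2nsq (h - F v) < e.
Proof.
move=> e0; have [g [/in_span_range[v ->] hv]] := M_outer (l2P h) e0.
by exists v.
Qed.

Let approx (h : l2 n W) := forall e : R, 0 < e ->
  exists g : l2 n V, g [::] = 0 /\ l2nsq (h - F g) < e.

Let approxD h h' : approx h -> approx h' -> approx (h + h').
Proof.
move=> ah ah' e e0.
have [|g [g0 hg]] := ah (e / 4); first by lra.
have [|g' [g0' hg']] := ah' (e / 4); first by lra.
exists (g + g'); split; first by rewrite l2D g0 g0' addr0.
rewrite (linD F_lin) opprD addrACA.
have := sqD_le (l2_form n W) (h - F g) (h' - F g'); rewrite !l2_sq; lra.
Qed.

Let approx0 : approx 0.
Proof.
move=> e e0; exists 0; split => //.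
by rewrite (lin0 F_lin) subrr -l2_sq (sq0 (l2_form n W)).
Qed.

Let approx_S i h : validg n i -> approx (l2S i h).
Proof.
move=> vi e e0; have [v hv] := outer_dense h e0.
exists (l2S i v); split; first exact: l2S_nil.
by rewrite F_S // -(linB (fun a f g => l2S_lin a f g vi)) l2S_sq.
Qed.

(** Every nonzero term of a truncation of [h] begins with a letter, hence is a shift [l2S i h']. If
    [F v] approximates [h'], then [F (l2S i v)] approximates this shift, and [l2S i v] vanishes at
    the empty word. *)
Lemma outer_dense_low (h : l2 n W) (e : R) : h [::] = 0 -> 0 < e ->
  exists g : l2 n V, g [::] = 0 /\ l2nsq (h - F g) < e.
Proof.
move=> h0 e0; have [|N NP] := @trunc_cvg R n W h (e / 4); first by lra.
have at' : approx (trunc (words n N) h).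
  rewrite /trunc big_seq; apply: big_ind => // w /words_valid.
  case: w => [_|i w /= /andP[vi vw]]; last exact: approx_S.
  by rewrite h0 /= (lin0 (@l2one_lin R n W)).
have [|g [g0 hg]] := at' (e / 4); first by lra.
exists g; split => //.
have -> : h - F g = (h - trunc (words n N) h) + (trunc (words n N) h - F g).
  by rewrite addrA subrK.
have := sqD_le (l2_form n W) (h - trunc (words n N) h) (trunc (words n N) h - F g).
rewrite !l2_sq; lra.
Qed.

(** [outer_dense_low] applied to [F v] with its vacuum component removed. *)
Lemma outer_vacuum (v : l2 n V) (e : R) : 0 < e -> exists g : l2 n V,
  g [::] = 0 /\ l2nsq (F (v - g) - l2one n (F v [::])) < e.
Proof.
move=> e0.
have [|g [g0 hg]] := @outer_dense_low (F v - l2one n (F v [::])) _ _ e0.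
  by rewrite l2B /= subrr.
by exists g; split => //; rewrite (linB F_lin) addrAC.
Qed.

End OuterDense.

(** * Comparison of two outer operators with equal norms *)

Section Uniqueness.
Variables (R : realType) (n : option nat) (E G G' : hilbert R).
Variables (F : l2 n E -> l2 n G) (F' : l2 n E -> l2 n G').
Hypothesis F_lin : forall a (f g : l2 n E), F (a *: f + g) = a *: F f + F g.
Hypothesis F_lin' : forall a (f g : l2 n E), F' (a *: f + g) = a *: F' f + F' g.
Hypothesis F_S : forall i f, validg n i -> F (l2S i f) = l2S i (F f).
Hypothesis F_S' : forall i f, validg n i -> F' (l2S i f) = l2S i (F' f).
Hypothesis F_low : forall g : l2 n E, g [::] = 0 -> F g [::] = 0.
Hypothesis F_low' : forall g : l2 n E, g [::] = 0 -> F' g [::] = 0.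
Hypothesis F_eq : forall f, l2nsq (F f) = l2nsq (F' f).
Hypothesis F_dense : forall (h : l2 n G) (e : R), 0 < e -> exists v, l2nsq (h - F v) < e.
Hypothesis F_dense' : forall (h : l2 n G') (e : R), 0 < e -> exists v, l2nsq (h - F' v) < e.
Hypothesis F_vac : forall (v : l2 n E) (e : R), 0 < e -> exists g : l2 n E,
  g [::] = 0 /\ l2nsq (F (v - g) - l2one n (F v [::])) < e.

Let low_eq (g v : l2 n E) : g [::] = 0 -> F (v - g) [::] = F v [::].
Proof. by move=> g0; rewrite (linB F_lin) l2B (F_low g0) subr0. Qed.

Let low_eq' (g v : l2 n E) : g [::] = 0 -> F' (v - g) [::] = F' v [::].
Proof. by move=> g0; rewrite (linB F_lin') l2B (F_low' g0) subr0. Qed.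

(** A Szego-type infimum: [hnormsq (F v [::])] is the infimum of [l2nsq (F (v - g))] over [g]
    vanishing at the empty word. These norms are the same for [F'], whose vacuum component is
    bounded by each of them. *)
Lemma vacuum_le v : hnormsq (F' v [::]) <= hnormsq (F v [::]).
Proof.
apply: (@le_of_small _ _ _ 1) => e /(F_vac v)[g [g0 hg]].
rewrite -(low_eq' v g0); apply: le_trans (hnormsq_le_fnormsq [::] (l2P _)) _.
by rewrite -/(l2nsq _) -F_eq l2nsq_vacuum low_eq // mulr1 lerD2l ltW.
Qed.

(** This is [vacuum_le] with the two operators exchanged. It is a hypothesis because the section
    fixes their roles; it is discharged by a second use of [vacuum_le] once the section is
    closed. *)
Hypothesis vacuum_ge : forall v, hnormsq (F v [::]) <= hnormsq (F' v [::]).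

Let vacuum_eq v : hnormsq (F v [::]) = hnormsq (F' v [::]).
Proof. by apply/eqP; rewrite eq_le vacuum_le vacuum_ge. Qed.

(** By Pythagoras the squared distance to the vacuum part is the squared norm minus that of the
    vacuum part, and both agree for [F] and [F']. *)
Let vac_both v (e : R) : 0 < e -> exists g : l2 n E,
  [/\ g [::] = 0, l2nsq (F (v - g) - l2one n (F v [::])) < e
    & l2nsq (F' (v - g) - l2one n (F' v [::])) < e].
Proof.
move=> /(F_vac v)[g [g0 hg]]; exists g; split => //.
have := l2nsq_vacuum (F (v - g)); have := l2nsq_vacuum (F' (v - g)).
rewrite low_eq // low_eq' // -F_eq vacuum_eq => -> /addrI ->.
exact: hg.
Qed.

Let gram u v : re (@l2inner R n G) (F u) (F v) = re (@l2inner R n G') (F' u) (F' v).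
Proof.
rewrite (re_polar (l2_form n G)) (re_polar (l2_form n G')) -(linD F_lin) -(linD F_lin').
by rewrite !l2_sq !F_eq.
Qed.

(** The left side is the inner product of [F f] with the vacuum vector of [F v] shifted by [w]. That
    vector is a limit of [F (l2Sw w (v - g))], for the same [g] on both sides, and inner products
    within the ranges agree by [gram]. *)
Lemma coef_gram f v w : validw n w ->
  re (@hinner R G) (F f w) (F v [::]) = re (@hinner R G') (F' f w) (F' v [::]).
Proof.
move=> vw; have FL := l2_form n G; have FL' := l2_form n G'.
have e1 : re (@hinner R G) (F f w) (F v [::]) =
    re (@l2inner R n G) (F f) (l2Sw w (l2one n (F v [::]))).
  by rewrite /re l2inner_Sw_one.
have e2 : re (@hinner R G') (F' f w) (F' v [::]) =
    re (@l2inner R n G') (F' f) (l2Sw w (l2one n (F' v [::]))).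
  by rewrite /re l2inner_Sw_one.
rewrite e1 e2; apply/eqP; rewrite -subr_eq0 -sqrf_eq0 eq_le sqr_ge0 andbT.
(* Both sides are compared with one common Gram value [a]; the square of the difference is at most
   twice the sum of two squares, each at most [e * l2nsq (F f)]. *)
apply: (@le0_of_small _ _ (4 * l2nsq (F f))) => e /(vac_both v)[g [g0 h1 h2]].
have Sl := @l2Sw_lin R n G w; have Sl' := @l2Sw_lin R n G' w.
have k1 := re_CS FL (F f) (l2Sw w (F (v - g) - l2one n (F v [::]))).
have k2 := re_CS FL' (F' f) (l2Sw w (F' (v - g) - l2one n (F' v [::]))).
rewrite !l2_sq !l2Sw_sq // in k1 k2.
rewrite (linB (fun a f g => Sl a f g vw)) (reBr FL) in k1.
rewrite (linB (fun a f g => Sl' a f g vw)) (reBr FL') in k2.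
rewrite -(multi_analytic_Sw F_S) // in k1; rewrite -(multi_analytic_Sw F_S') // in k2.
rewrite -gram -F_eq in k2.
have m1 : l2nsq (F f) * l2nsq (F (v - g) - l2one n (F v [::])) <= e * l2nsq (F f).
  by rewrite mulrC; apply: ler_wpM2r; [exact: fnormsq_ge0 (l2P _)|exact: ltW].
have m2 : l2nsq (F f) * l2nsq (F' (v - g) - l2one n (F' v [::])) <= e * l2nsq (F f).
  by rewrite mulrC; apply: ler_wpM2r; [exact: fnormsq_ge0 (l2P _)|exact: ltW].
have := le_trans k1 m1; have := le_trans k2 m2.
have -> : e * (4 * l2nsq (F f)) = 2 * (e * l2nsq (F f)) + 2 * (e * l2nsq (F f)).
  by ring.
set a := re (@l2inner R n G) (F f) (F _).
set x := re (@l2inner R n G) (F f) (l2Sw _ _).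
set y := re _ (F' f) _; set d := e * _.
move=> h h'.
have := sqr_ge0 ((a - x) + (a - y)); lra.
Qed.

(** Vacuum values are dense in [G] and [G'], because evaluation at the empty word is a contraction
    on the dense ranges. So [U] is determined there, and testing against vacuum values with
    [coef_gram] extends the identity to every word. *)
Lemma coefs_unitary : exists U : G -> G', unitary U /\
  forall f w, F' f w = U (F f w).
Proof.
have FG := hform G; have FG' := hform G'.
have l1 a (u v : l2 n E) : F (a *: u + v) [::] = a *: F u [::] + F v [::].
  by rewrite F_lin.
have l2 a (u v : l2 n E) : F' (a *: u + v) [::] = a *: F' u [::] + F' v [::].
  by rewrite F_lin'.
have d1 : forall x : G, (forall v, hinner x (F v [::]) = 0) -> x = 0.
  apply: orth0_of_dense => x e e0; have [v hv] := F_dense (l2one n x) e0.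
  by exists v; exact: le_lt_trans (hnormsq_le_fnormsq [::] (l2P _)) hv.
have d2 : forall x : G', (forall v, hinner x (F' v [::]) = 0) -> x = 0.
  apply: orth0_of_dense => x e e0; have [v hv] := F_dense' (l2one n x) e0.
  by exists v; exact: le_lt_trans (hnormsq_le_fnormsq [::] (l2P _)) hv.
have [U [[U_lin U_iso U_onto] UP]] := dense_isometry l1 l2 d1 d2 vacuum_eq.
exists U; split => // f w.
case vw : (validw n w); last first.
  by rewrite (l2P (F f)).2 ?vw // (l2P (F' f)).2 ?vw // (lin0 U_lin).
apply/eqP; rewrite -subr_eq0; apply/eqP; apply: d2 => v.
rewrite (formBl FG') -UP U_iso; apply/eqP; rewrite subr_eq0; apply/eqP.
have iF : 'i%C *: F v [::] = F ('i%C *: v) [::] by rewrite (linZ F_lin).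
have iF' : 'i%C *: U (F v [::]) = F' ('i%C *: v) [::].
  by rewrite UP (linZ F_lin').
by rewrite (form_re FG) (form_re FG') iF iF' UP !coef_gram.
Qed.

End Uniqueness.

Lemma max_outer_factor_unique (R : realType) (n : option nat) (E G G' : hilbert R)
    (T : fock E -> fock E) (phi : fock E -> fock G) (phi' : fock E -> fock G') :
  max_outer_factor n T phi -> max_outer_factor n T phi' ->
  exists U : G -> G', unitary U /\
    (forall f : fock E, inl2 n f -> phi' f = (fun w => U (phi f w))).
Proof.
case=> [ma out le max] [ma' out' le' max'].
have [F [FE F_lin F_S [c [c0 F_le]]]] := multi_analytic_lift ma.
have [F' [FE' F_lin' F_S' [c' [c0' F_le']]]] := multi_analytic_lift ma'.
have F_eq f : l2nsq (F f) = l2nsq (F' f).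
  (* Each factor is a competitor in the maximality of the other. *)
  have := max _ _ ma' le' _ (l2P f); have := max' _ _ ma le _ (l2P f).
  rewrite -[l2val f]/(val f) -FE -FE' => h h'.
  by apply/eqP; rewrite eq_le h h'.
have F_low (g : l2 n E) : g [::] = 0 -> F g [::] = 0.
  move=> g0; apply: (@multi_analytic_low _ _ _ _ _ _ F_lin F_S c0 F_le 1) => //.
  by case.
have F_low' (g : l2 n E) : g [::] = 0 -> F' g [::] = 0.
  move=> g0; apply: (@multi_analytic_low _ _ _ _ _ _ F_lin' F_S' c0' F_le' 1) => //.
  by case.
have F_vac := outer_vacuum FE F_lin F_S out.
have F_vac' := outer_vacuum FE' F_lin' F_S' out'.
have F_dense := outer_dense FE F_lin F_S out.
have F_dense' := outer_dense FE' F_lin' F_S' out'.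
have vac_ge v := vacuum_le F_lin' F_lin F_low' F_low (fun f => esym (F_eq f)) F_vac' v.
have [U [Uu UP]] := coefs_unitary F_lin F_lin' F_S F_S' F_low F_low' F_eq F_dense
  F_dense' F_vac vac_ge.
exists U; split => // f fl; apply/funext => w.
rewrite -(mkl2E fl) -[l2val _]/(val _) -FE -FE'; exact: UP.
Qed.

Theorem mainTheorem1 (R : realType) (n : option nat) (hn : n <> Some 0%N)
  (E : hilbert R) (T : fock E -> fock E) :
  multi_toeplitz n T -> positive_op n T ->
  (exists (G : hilbert R) (phi : fock E -> fock G), max_outer_factor n T phi) /\
  (forall (G G' : hilbert R) (phi : fock E -> fock G) (phi' : fock E -> fock G'),
     max_outer_factor n T phi -> max_outer_factor n T phi' ->
     exists U : G -> G', unitary U /\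
       (forall f : fock E, inl2 n f -> phi' f = (fun w => U (phi f w)))).
Proof.
move=> Tt Tp; split; first exact: max_outer_factor_exists.
by move=> G G' phi phi'; exact: max_outer_factor_unique.
Qed.
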